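(* Suppose $X$ is a disconnected, unbounded, locally compact, and uniformly bi-Lipschitz homogeneous metric space. If $X$ is quasi-invertible, then $X$ is quasi-Möbius homeomorphic to $(C_2,\rho_2)$.
   Context: Write $a\simeq_L b$ for $L^{-1}b\le a\le Lb$. $X$ is uniformly bi-Lipschitz homogeneous if there is $L\ge1$ such that for all $x,y\in X$ there is a homeomorphism $f:X\to X$ with $f(x)=y$ and $d(f(u),f(v))\simeq_L d(u,v)$ for all $u,v\in X$. $X$ is quasi-invertible if for some $p\in X$ and $L\ge1$ there is a homeomorphism $\sigma_p:X\setminus\{p\}\to X\setminus\{p\}$ with $d(\sigma_p(x),\sigma_p(y))\simeq_L\dfrac{d(x,y)}{d(x,p)\,d(y,p)}$ for all $x,y\in X\setminus\{p\}$. A homeomorphism $f:X\to Y$ between metric spaces is quasi-Möbius if there is a homeomorphism $\theta:[0,\infty)\to[0,\infty)$ such that for all quadruples of distinct points $a,b,c,e\in X$, $\dfrac{d(f(a),f(c))\,d(f(b),f(e))}{d(f(a),f(e))\,d(f(b),f(c))}\le\theta\!\left(\dfrac{d(a,c)\,d(b,e)}{d(a,e)\,d(b,c)}\right)$. $C_2$ is the set of sequences $\xi=(\xi_i)_{i\in\mathbb{Z}}$ with $\xi_i\in\{1,2\}$ for all $i$ and for which there is $m\in\mathbb{Z}$ with $\xi_i=1$ for all $i\le m$; $\rho_2(\xi,\zeta)=2^{-m(\xi,\zeta)}$ where $m(\xi,\zeta)=\sup\{m\in\mathbb{Z}:\xi_i=\zeta_i\text{ for all }i\le m\}$ (so $\rho_2(\xi,\xi)=0$).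 *)

(* Defs.v *)
From HB Require Import structures.
From mathcomp Require Import all_boot all_order all_algebra.
From mathcomp Require Import all_classical all_reals all_analysis.
From mathcomp Require Import zify.

Set Implicit Arguments.
Unset Strict Implicit.
Unset Printing Implicit Defensive.

Import Order.TTheory GRing.Theory Num.Theory.
Import numFieldTopology.Exports.

Local Open Scope classical_set_scope.
Local Open Scope ring_scope.

Definition homeomorphism_on {T U : topologicalType} (A : set T) (B : set U)
    (f : T -> U) : Prop :=
  [/\ {within A, continuous f}, set_fun A B f
    & exists g : U -> T, [/\ {within B, continuous g}, set_fun B A g,
        {in A, cancel f g} & {in B, cancel g f}]].

Definition homeomorphism {T U : topologicalType} (f : T -> U) : Prop :=
  homeomorphism_on [set: T] [set: U] f.

(* a \simeq_L b *)
Definition comparable_up_to {R : realType} (L a b : R) : bool :=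
  L^-1 * b <= a <= L * b.

Definition unbounded {R : realType} (X : metricType R) : Prop :=
  ~ exists M : R, forall x y : X, mdist x y <= M.

Definition uniformly_bilipschitz_homogeneous {R : realType}
    (X : metricType R) : Prop :=
  exists2 L : R, 1 <= L & forall x y : X, exists f : X -> X,
    [/\ homeomorphism f, f x = y
      & forall u v, comparable_up_to L (mdist (f u) (f v)) (mdist u v)].

(* The value of sigma at p is irrelevant. *)
Definition quasi_invertible {R : realType} (X : metricType R) : Prop :=
  exists (p : X) (L : R) (sigma : X -> X),
    [/\ 1 <= L, homeomorphism_on (~` [set p]) (~` [set p]) sigma
      & forall x y, x != p -> y != p ->
          comparable_up_to L (mdist (sigma x) (sigma y))
            (mdist x y / (mdist x p * mdist y p))].

Definition cross_ratio {R : realType} {X : metricType R} (a b c e : X) : R :=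
  (mdist a c * mdist b e) / (mdist a e * mdist b c).

Definition quasi_moebius {R : realType} {X Y : metricType R}
    (f : X -> Y) : Prop :=
  homeomorphism f /\
  exists2 theta : R -> R,
      @homeomorphism_on R R `[0, +oo[ `[0, +oo[ theta
    & forall a b c e : X, uniq [:: a; b; c; e] ->
        cross_ratio (f a) (f b) (f c) (f e) <= theta (cross_ratio a b c e).

Definition C2_sequences : set (int -> nat) :=
  [set xi | (forall i, xi i = 1%N \/ xi i = 2%N) /\
            exists m : int, forall i, i <= m -> xi i = 1%N].

(* R is the field in which the metric below takes its values. *)
Definition C2 (R : realType) : Type := set_type C2_sequences.

Definition C2_seq {R : realType} (xi : C2 R) : int -> nat := \val xi.

HB.instance Definition _ (R : realType) :=
  Choice.copy (C2 R) (set_type C2_sequences).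

Definition agreement {R : realType} (xi zeta : C2 R) : set int :=
  [set m | forall i, i <= m -> C2_seq xi i = C2_seq zeta i].

(* For xi = zeta the supremum is +oo, whence the separate case. *)
Definition rho2 {R : realType} (xi zeta : C2 R) : R :=
  if xi == zeta then 0 else 2 ^ (- supremum 0 (agreement xi zeta)).

Section C2_metric.
Context {R : realType}.
Implicit Types xi zeta eta : C2 R.

Lemma agreementC xi zeta : agreement xi zeta = agreement zeta xi.
Proof. by apply/seteqP; split => m /= + i im => /(_ i im). Qed.

Lemma rho2P xi zeta : xi != zeta -> exists m : int,
  [/\ rho2 xi zeta = 2 ^ (- m), agreement xi zeta m
    & C2_seq xi (m + 1) != C2_seq zeta (m + 1)].
Proof.
move=> xz.
have [[m0 Em0] [k kP]] : agreement xi zeta !=set0 /\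
    exists k, C2_seq xi k != C2_seq zeta k.
  split.
    have [_ [m1 h1]] := set_valP xi; have [_ [m2 h2]] := set_valP zeta.
    exists (Order.min m1 m2) => i; rewrite le_min => /andP[i1 i2].
    by rewrite /C2_seq h1 ?h2.
  apply: contrapT => /forallNP h; move/eqP: xz; apply; apply: val_inj.
  by apply/funext => i; apply/eqP/negPn/negP/h.
have m0k : m0 < k.
  by rewrite ltNge; apply/negP => /Em0 e; rewrite e eqxx in kP.
have gap (i j : int) : i < j -> exists n : nat, j = i + n%:Z + 1.
  by move=> ij; exists (absz (j - i - 1)%R); lia.
have [n nP nmin] : exists2 n : nat, C2_seq xi (m0 + n%:Z + 1)
      != C2_seq zeta (m0 + n%:Z + 1)
    & forall j : nat, (j < n)%N ->
      C2_seq xi (m0 + j%:Z + 1) = C2_seq zeta (m0 + j%:Z + 1).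
  have ex : exists n : nat,
      C2_seq xi (m0 + n%:Z + 1) != C2_seq zeta (m0 + n%:Z + 1).
    by have [n kE] := gap _ _ m0k; exists n; rewrite -kE.
  exists (ex_minn ex); case: ex_minnP => // n _ h j jn.
  by apply/eqP/negPn/negP => /h; rewrite leqNgt jn.
have Em : agreement xi zeta (m0 + n%:Z).
  move=> i im; have [/Em0//|m0i] := leP i m0.
  by have [j iE] := gap _ _ m0i; rewrite iE; apply: nmin; lia.
have ub : ubound (agreement xi zeta) (m0 + n%:Z).
  move=> m' Em'; rewrite leNgt; apply/negP; rewrite -lezD1 => /Em' e.
  by rewrite e eqxx in nP.
exists (m0 + n%:Z); split => //; rewrite /rho2 (negPf xz); congr (_ ^ (- _)).
rewrite /supremum ifF; last by apply/negP => /eqP E; rewrite E in Em0.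
have sm : supremums (agreement xi zeta) (m0 + n%:Z) by split => // u; apply.
by apply: (is_subset1_supremums _ sm); case: xgetP => // /(_ _ sm).
Qed.

Lemma rho2xx xi : rho2 xi xi = 0.
Proof. by rewrite /rho2 eqxx. Qed.

Lemma rho2_eq0 xi zeta : rho2 xi zeta = 0 -> xi = zeta.
Proof.
move=> e; apply/eqP/negPn/negP => /rho2P[m [+ _ _]].
by rewrite e => /esym/eqP; rewrite expfz_eq0 pnatr_eq0 andbF.
Qed.

Lemma rho2_sym xi zeta : rho2 xi zeta = rho2 zeta xi.
Proof. by rewrite /rho2 eq_sym agreementC. Qed.

Lemma rho2_ge0 xi zeta : 0 <= rho2 xi zeta.
Proof. by rewrite /rho2; case: ifP => // _; rewrite exprz_ge0. Qed.

Lemma rho2_triangle eta xi zeta : rho2 xi zeta <= rho2 xi eta + rho2 eta zeta.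
Proof.
have [->|xz] := eqVneq xi zeta; first by rewrite rho2xx addr_ge0 ?rho2_ge0.
have [->|xe] := eqVneq xi eta; first by rewrite rho2xx add0r.
have [->|ez] := eqVneq eta zeta; first by rewrite rho2xx addr0.
have [n [-> _ nP]] := rho2P xz.
have [a [ra Ea _]] := rho2P xe; have [b [rb Eb _]] := rho2P ez.
have [an|na] := leP a n.
  rewrite ra ler_wpDr ?rho2_ge0// ler_eXz2l ?lerN2//.
  by rewrite ltr1n.
have [bn|nb] := leP b n.
  rewrite rb ler_wpDl ?rho2_ge0// ler_eXz2l ?lerN2//.
  by rewrite ltr1n.
by rewrite Ea ?lezD1// Eb ?lezD1// eqxx in nP.
Qed.

End C2_metric.

HB.instance Definition _ (R : realType) := @isMetric.Build R (C2 R)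
  rho2 rho2xx rho2_eq0 rho2_sym rho2_triangle.

(* Main.v *)
Require Import Defs.
From HB Require Import structures.
From mathcomp Require Import all_boot all_order all_algebra.
From mathcomp Require Import all_classical all_reals all_analysis.
From mathcomp Require Import zify ring lra.

(** Write d for the distance of X, and say that two quantities are comparable
when their ratio lies between two positive constants that depend on X only.
The space X turns out to look the same at every place and at every scale, and
to be a Cantor set at one scale; this makes it a tree with bounded branching,
and the boundary of such a tree is a quasi-Moebius copy of the boundary of the
binary tree.

Self-similarity.  Conjugating the given inversion by bi-Lipschitz
homeomorphisms gives an inversion tau at every point q, with uniform constants
([inversion_conj]).  On a ball around x that is small compared with D = d(x, q)
the map tau multiplies all distances by about D^-2.  Hence the set of distances
of X is stable, up to constants, under D |-> 1 / D and, for a fixed small D,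
under t |-> t / D^2 on small t; so it meets every interval [t / K, K t]
([distance_dense]), every factor D^-2 is available, and composing two such maps
rescales any ball by any factor ([scaling]).  Properties of one ball therefore
propagate to all balls: local compactness gives completeness and doubling, and
the existence of two points gives uniform perfectness.

Disconnectedness.  Suppose that X has no nonempty bounded clopen set.  A
separation X = U + V with p in U gives, by inversion at p, a petal at p: the
bounded closed set P = tau(V) + p, attached to the rest of X at the single
point p.  A petal attached at a point y of P other than p must stay inside P
([petal_nested]), because otherwise the difference or the union of the two
petals would be clopen and bounded.  But inverting the complement of P at a
point q of P very close to p produces arbitrarily large petals, which
homogeneity moves to q ([petal_blowup]): a contradiction.  This is the classical
argument that in a continuum not every point is a cut point, with size playing
the role of a maximal chain.  So X has a bounded clopen set
([bounded_clopen_exists]); an inversion shrinks it into a compact ball, where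
it is separated from its complement by a positive gap, and rescaling turns the
gap into uniform disconnectedness ([disconnected_of_compact_open]).

Uniformization.  For a large M, say that x and y are equivalent at level k when
a chain of steps shorter than delta M^k joins them.  Uniform disconnectedness
makes the classes of level k sets of diameter at most M^k, while distinct ones
lie delta M^k apart; uniform perfectness and doubling say that each class splits
into at least 2 and at most N classes of the next lower level
([scale_tower]).  Number the n children of a class from 0, with the child
containing a base point first, and give child i the word 2^i 1, or 2^(n-1) for
the last one.  This is a complete prefix code, so concatenating words along the
branch of x is a bijection of X with C_2.  One level of the tower has word
length between 1 and N, so level differences and position differences along a
branch are comparable; since a cross-ratio is, up to a constant factor, the
exponential of a signed length of a segment in the tree spanned by the four
points, its logarithm is distorted by at most a bounded factor and a bounded
summand ([squeezed_cross]), which is the quasi-Moebius condition with a gauge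
built from a power and a root ([coding_cross_ratio]). *)

Set Implicit Arguments.
Unset Strict Implicit.
Unset Printing Implicit Defensive.
Import Order.TTheory GRing.Theory Num.Theory.
Import numFieldNormedType.Exports.

Local Open Scope classical_set_scope.
Local Open Scope ring_scope.

(** * Coding a tower of partitions by binary sequences *)

(** Nested partitions of T indexed by the integers, E k becoming coarser as k
grows: the vertices of the tree of which T is the set of ends.  The last field
says that the classes along an infinite descending branch have a common
point. *)
Record partition_tower (T : choiceType) (E : int -> T -> T -> Prop) (N : nat) :
    Prop := PartitionTower {
  tower_refl : forall k x, E k x x ;
  tower_sym : forall k x y, E k x y -> E k y x ;
  tower_trans : forall k y x z, E k x y -> E k y z -> E k x z ;
  tower_coarsen : forall k x y, E k x y -> E (k + 1) x y ;
  tower_split : forall k x, exists2 y, E (k + 1) x y & ~ E k x y ;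
  tower_bound : forall k x (s : seq T), (forall y, y \in s -> E (k + 1) x y) ->
    (forall i j, (i < j < size s)%N -> ~ E k (nth x s i) (nth x s j)) ->
    (size s <= N)%N ;
  tower_join : forall x y, exists k, E k x y ;
  tower_separated : forall x y, (forall k, E k x y) -> x = y ;
  tower_complete : forall (k : int) (u : nat -> T),
    (forall n, E (k - n%:Z) (u n) (u n.+1)) ->
    exists x, forall n, E (k - n%:Z) (u n) x }.

Section coding.
Context (T : choiceType) (E : int -> T -> T -> Prop) (N : nat) (p : T).
Hypothesis tE : partition_tower E N.
Implicit Types (k l : int) (x y z : T).

Lemma tower_le k l x y : k <= l -> E k x y -> E l x y.
Proof.
move=> kl Exy; have -> : l = k + `|l - k|%N%:Z by lia.
elim: `|l - k|%N => [|n IH]; first by rewrite addr0.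
by rewrite -addn1 PoszD addrA; apply: (tower_coarsen tE).
Qed.

(** The class of p is given the label 0 so that, at the high levels where the
class of a given point contains p, its word is the single letter 1: this is why
codes are eventually 1 on the left. *)
Definition child_labels k (A : set T) (v : (T -> nat) * nat) :=
  [/\ (1 < v.2 <= N)%N,
      forall y z, A y -> A z -> v.1 y = v.1 z <-> E k y z,
      forall y, A y -> (v.1 y < v.2)%N,
      forall i, (i < v.2)%N -> exists2 y, A y & v.1 y = i
    & A p -> v.1 p = 0%N].

Definition parent k x : set T := [set y | E (k + 1) x y].

(** List pairwise inequivalent points of the class, starting from p if p is
among them.  Since [tower_bound] limits the length of such lists, one of maximal
length exists, and it represents every child; the label of y is the position of
its representative. *)
Lemma child_labels_exist k x : exists v, child_labels k (parent k x) v.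
Proof.
pose x0 := if `[<E (k + 1) x p>] then p else x.
have Ax0 : E (k + 1) x x0.
  by rewrite /x0; case: asboolP => // _; exact: (tower_refl tE).
pose good (s : seq T) := (forall y, y \in x0 :: s -> E (k + 1) x y) /\
  forall i j, (i < j < (size s).+1)%N ->
    ~ E k (nth x (x0 :: s) i) (nth x (x0 :: s) j).
pose P n := `[<exists2 s, size s = n & good s>].
have exP : exists n, P n.
  exists 0%N; apply/asboolP; exists [::] => //; split=> [y|i j].
    by rewrite inE => /eqP ->.
  by rewrite /=; lia.
have ubP n : P n -> (n <= N)%N.
  move=> /asboolP[s <- [sA sE]]; apply: ltnW.
  exact: (tower_bound tE sA sE).
case: (ex_maxnP exP ubP) => n /asboolP[s ss [sA sE]] nmax.
pose t := x0 :: s; pose g y := find (fun z => `[<E k y z>]) t.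
have gt y : E (k + 1) x y -> has (fun z => `[<E k y z>]) t.
  move=> Ay; apply/negPn/negP => /hasPn ynt.
  suff : P n.+1 by move=> /nmax; rewrite ltnn.
  apply/asboolP; exists (rcons s y); first by rewrite size_rcons ss.
  split=> [z|i j].
    by rewrite -rcons_cons mem_rcons inE => /predU1P[->//|/sA].
  rewrite -rcons_cons size_rcons !nth_rcons /= => /andP[ij jn].
  have iS : (i < (size s).+1)%N by lia.
  rewrite iS; case: ifP => jS; first by apply: sE; lia.
  have -> : j == (size s).+1 by lia.
  move=> /(tower_sym tE) Eyi; have := ynt (nth x t i).
  by rewrite mem_nth// => /(_ isT)/asboolP.
have gE y : E (k + 1) x y -> E k y (nth x t (g y)).
  by move=> /gt/(nth_find x)/asboolP.
have gi i : (i < size t)%N -> g (nth x t i) = i.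
  move=> it; apply/eqP; rewrite eqn_leq; apply/andP; split.
    rewrite leqNgt; apply/negP => /(before_find x)/asboolP.
    by apply; exact: (tower_refl tE).
  rewrite leqNgt; apply/negP => ig.
  have := sE (g (nth x t i)) i; rewrite ig => /(_ it); apply.
  by apply: (tower_sym tE); apply: gE; apply: sA; rewrite mem_nth.
exists (g, size t); split => /=.
- have [y Ay nEy] := tower_split tE k x.
  have xx : E (k + 1) x x by exact: (tower_refl tE).
  have gxy : g x <> g y.
    move=> gxy; apply: nEy; apply: (tower_trans tE (gE _ xx)); rewrite gxy.
    by apply: (tower_sym tE); exact: gE.
  have := gt _ xx; have := gt _ Ay; rewrite !has_find -/(g x) -/(g y) /= => ? ?.
  apply/andP; split; first by lia.
  exact: (tower_bound tE sA sE).
- move=> y z Ay Az; split=> [gyz|Eyz].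
    apply: (tower_trans tE (gE _ Ay)); rewrite gyz.
    by apply: (tower_sym tE); exact: gE.
  apply: eq_find => w; apply/asboolP/asboolP => ?.
    by apply: (tower_trans tE _) (_ : E k y w) => //; exact: (tower_sym tE).
  exact: (tower_trans tE Eyz).
- by move=> y /gt; rewrite has_find.
- by move=> i it; exists (nth x t i); [apply: sA; rewrite mem_nth|exact: gi].
- move=> Ap; have -> : p = nth x t 0 by rewrite /t /x0 /=; case: asboolP.
  exact: gi.
Qed.

(** The choice depends on the class as a set and not on a point of it, so that
equivalent points are labelled by the same function. *)
Definition labels k (A : set T) : (T -> nat) * nat :=
  xget (fun=> 0%N, 0%N) (child_labels k A).

Definition idx k x := (labels k (parent k x)).1 x.
Definition arity k x := (labels k (parent k x)).2.

Lemma labelsP k x : child_labels k (parent k x) (labels k (parent k x)).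
Proof.
rewrite /labels; case: xgetP => // none.
by have [v /none] := child_labels_exist k x.
Qed.

Lemma parentE k x y : E (k + 1) x y -> parent k y = parent k x.
Proof.
move=> Exy; apply/seteqP; split=> z Ez; apply: (tower_trans tE _ Ez) => //.
exact: (tower_sym tE).
Qed.

Lemma parentxx k x : parent k x x.
Proof. exact: (tower_refl tE). Qed.

Lemma arity_parent k x y : E (k + 1) x y -> arity k x = arity k y.
Proof. by move=> /parentE Exy; rewrite /arity Exy. Qed.

Lemma arity_bounds k x : (1 < arity k x <= N)%N.
Proof. by have [] := labelsP k x. Qed.

Lemma idxP k x y : E (k + 1) x y -> idx k x = idx k y <-> E k x y.
Proof.
move=> Exy; have [_ + _ _ _] := labelsP k x.
by rewrite /idx (parentE Exy); apply=> //; exact: parentxx.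
Qed.

Lemma idx_eq k x y : E k x y -> idx k x = idx k y.
Proof. by move=> Exy; apply/idxP => //; exact: (tower_coarsen tE). Qed.

Lemma idx_lt k x : (idx k x < arity k x)%N.
Proof. by have [_ _ + _ _] := labelsP k x; apply; exact: parentxx. Qed.

Lemma idx_surj k x i : (i < arity k x)%N ->
    exists2 y, E (k + 1) x y & idx k y = i.
Proof.
have [_ _ _ + _] := labelsP k x => /[apply] -[y Exy <-].
by exists y => //; rewrite /idx (parentE Exy).
Qed.

Lemma idx_base k x : E k x p -> idx k x = 0%N.
Proof.
by move=> /idx_eq ->; have [_ _ _ _] := labelsP k p; apply; exact: parentxx.
Qed.

(** The length of the code word of the child: 2^i 1 for child i < n - 1 and
2^(n-1) for child n - 1, where n is the arity. *)
Definition code_len k x := minn (idx k x).+1 (arity k x).-1.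

Lemma code_len_bounds k x :
    (0 < code_len k x <= N)%N /\ (idx k x <= code_len k x)%N.
Proof.
by rewrite /code_len; have := arity_bounds k x; have := idx_lt k x; lia.
Qed.

Lemma code_len_eq k x y : E k x y -> code_len k x = code_len k y.
Proof.
move=> Exy; rewrite /code_len (idx_eq Exy) (arity_parent (tower_coarsen tE
    Exy)) //.
Qed.

Lemma code_len_base k x : E k x p -> code_len k x = 1%N.
Proof.
by move=> /idx_base; rewrite /code_len; have := arity_bounds k x; lia.
Qed.

Definition base_level x : int := sval (cid (tower_join tE x p)).

Lemma base_levelP x k : base_level x <= k -> E k x p.
Proof. by move=> /tower_le; apply; rewrite /base_level; case: cid. Qed.

(** The place in the code of x where the word of its class of level k ends, and
where the word of level k - 1 begins.  It is the sum of the word lengths of all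
levels at least k, normalized to be - k on the branch of p; summing the excess
over 1 keeps the sum finite. *)
Definition code_pos k x : int :=
  - k + (\sum_(i < `|base_level x - k|) (code_len (k + i%:Z) x).-1)%N%:Z.

(** Above the level where x meets p all words have length 1, so the sum may be
cut anywhere beyond it. *)
Lemma code_posE n k x : base_level x <= k + n%:Z ->
  code_pos k x = - k + (\sum_(i < n) (code_len (k + i%:Z) x).-1)%N%:Z.
Proof.
pose F m := (\sum_(i < m) (code_len (k + i%:Z) x).-1)%N.
suff FE m j : base_level x <= k + m%:Z -> F (m + j)%N = F m.
  rewrite /code_pos -!/(F _) => kn; congr (- k + Posz _).
  have [mn|/ltnW nm] := leqP `|base_level x - k| n.
    by rewrite -(subnKC mn) FE//; lia.
  by rewrite -(subnKC nm) FE.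
move=> km; elim: j => [|j IH]; first by rewrite addn0.
rewrite addnS /F big_ord_recr/= -/(F _) IH code_len_base ?addn0//.
by apply: base_levelP; move: km; rewrite PoszD; lia.
Qed.

Lemma code_pos_step k x : code_pos k x = code_pos (k + 1) x + (code_len k x)%:Z.
Proof.
pose n := `|base_level x - k|%N.
rewrite (@code_posE n.+1) ?(@code_posE n (k + 1)); try by lia.
rewrite big_ord_recl/= addr0 /bump/=.
under eq_bigr do rewrite PoszD addrA -[Posz 1]/(1 : int).
have [/andP[l1 _] _] := code_len_bounds k x.
by move: (code_len k x) l1 (\sum_(i < n) _)%N => a a_gt0 S; lia.
Qed.

Lemma code_pos_base k x : E k x p -> code_pos k x = - k.
Proof.
move=> Exp; rewrite /code_pos big1 ?addr0// => i _.
by rewrite code_len_base//; apply: tower_le Exp; lia.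
Qed.

Lemma code_pos_eq k x y : E k x y -> code_pos k x = code_pos k y.
Proof.
move=> Exy; pose n := (`|base_level x - k| + `|base_level y - k|)%N.
rewrite (@code_posE n) ?(@code_posE n k y); try by lia.
congr (_ + Posz _); apply: eq_bigr => i _; congr _.-1; apply: code_len_eq.
by apply: tower_le Exy; lia.
Qed.

(** The source of all estimates: lengths of words are between 1 and N, so along
one branch positions and levels are comparable. *)
Lemma code_pos_le k l x : k <= l ->
  l - k <= code_pos k x - code_pos l x <= N%:Z * (l - k).
Proof.
move=> kl; have -> : l = k + `|l - k|%N%:Z by lia.
elim: `|l - k|%N => [|n IH]; first by rewrite addr0 !subrr mulr0 lexx.
have := code_pos_step (k + n%:Z) x; have [] := code_len_bounds (k + n%:Z) x.
have -> : k + n.+1%:Z = k + n%:Z + 1 by lia.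
nia.
Qed.

Lemma code_pos_mono k l x : code_pos l x < code_pos k x -> k < l.
Proof.
by move=> ?; rewrite ltNge; apply/negP => lk; have := code_pos_le x lk; lia.
Qed.

(** The letters 2 of a word come first, hence the interval; a letter 1 is used
only to end a word. *)
Definition word x i : nat :=
  if `[<exists k, code_pos (k + 1) x <= i < code_pos (k + 1) x + (idx k x)%:Z>]
  then 2%N else 1%N.

(** Blocks of different levels occupy disjoint intervals, so the letters of one
block can be read off without looking at the others. *)
Lemma word_block k x (j : nat) : (j < code_len k x)%N ->
  word x (code_pos (k + 1) x + j%:Z) = if (j < idx k x)%N then 2%N else 1%N.
Proof.
move=> jlen; rewrite /word; case: asboolP => [[l jl]|nex]; last first.
  by case: ifP => // jidx; case: nex; exists k; lia.
suff lk : l = k by rewrite lk in jl; have -> : (j < idx k x)%N by lia.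
have [_ lidx] := code_len_bounds l x.
have := code_pos_step k x; have := code_pos_step l x => posl posk.
have kl1 : k < l + 1 by apply: (@code_pos_mono _ _ x); lia.
have lk1 : l < k + 1 by apply: (@code_pos_mono _ _ x); lia.
lia.
Qed.

Lemma word_agree k x y i : E k x y -> i < code_pos k x -> word x i = word y i.
Proof.
have one u v : E k u v -> i < code_pos k u ->
    (exists k, code_pos (k + 1) u <= i < code_pos (k + 1) u + (idx k u)%:Z) ->
    exists k, code_pos (k + 1) v <= i < code_pos (k + 1) v + (idx k v)%:Z.
  move=> Euv ik [l il]; have kl : k < l + 1 by apply: (@code_pos_mono _ _ u);
      lia.
  have Eluv : E l u v by apply: tower_le Euv; lia.
  by exists l; rewrite -(idx_eq Eluv) -(code_pos_eq (tower_coarsen tE Eluv)).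
move=> Exy ik; rewrite /word; congr (if _ then _ else _).
apply/asboolP/asboolP; first exact: one.
by apply: one; [exact: (tower_sym tE)|rewrite -(code_pos_eq Exy)].
Qed.

(** Two children i < j of the same class are told apart by letter i of their
words, counted from 0, which ends the word of child i and is a 2 in that of
child j. *)
Lemma word_differ k x y : E (k + 1) x y -> ~ E k x y ->
  exists2 j : nat, (j < N)%N &
    word x (code_pos (k + 1) x + j%:Z) <> word y (code_pos (k + 1) x + j%:Z).
Proof.
wlog xy : x y / (idx k x < idx k y)%N => [hw Exy nExy|Exy nExy].
  have [xy|yx|/idxP-/(_ Exy)//] := ltngtP (idx k x) (idx k y).
    exact: hw.
  have Eyx : E (k + 1) y x by exact: (tower_sym tE).
  have nEyx : ~ E k y x by move/(tower_sym tE).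
  have [j jN wj] := hw _ _ yx Eyx nEyx.
  by exists j => //; rewrite (code_pos_eq Exy); exact: nesym.
have := arity_bounds k x; have := idx_lt k y;
    rewrite -(arity_parent Exy) => ? ?.
exists (idx k x); first by lia.
rewrite word_block ?ltnn; last by rewrite /code_len; lia.
rewrite (code_pos_eq Exy) word_block ?xy//.
by rewrite /code_len -(arity_parent Exy); lia.
Qed.

Lemma word_C2 x : C2_sequences (word x).
Proof.
split=> [i|]; first by rewrite /word; case: asboolP; [right|left].
exists (- base_level x - 1) => i itop; rewrite /word;
    case: asboolP => // -[k ki].
have idx0 : (0 < idx k x)%N by lia.
have kt : k < base_level x.
  by rewrite ltNge; apply/negP => /base_levelP/idx_base; lia.
have := @code_pos_le (k + 1) (base_level x) x;
    rewrite (code_pos_base (base_levelP (lexx _))).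
by lia.
Qed.

(** The code is complete as well as prefix-free, so from any position of xi one
can read the next child.  Starting high up on the branch of p this descends
through nested classes, and [tower_complete] gives the point coded by xi. *)
Lemma word_surj xi : C2_sequences xi -> exists x, word x = xi.
Proof.
move=> [xi12 [m xi1]]; pose k : int := - m - 1.
have step (n : nat) x : exists y, (forall i, i < code_pos (k - n%:Z) x ->
    word x i = xi i) ->
    E (k - n%:Z) x y /\ forall i, i < code_pos (k - n.+1%:Z) y ->
        word y i = xi i.
  have [xxi|xxi] := pselect (forall i, i < code_pos (k - n%:Z) x ->
      word x i = xi i);
    last by exists x.
  have -> : k - n.+1%:Z = k - n%:Z - 1 by lia.
  have : k - n%:Z = (k - n%:Z - 1) + 1 by lia.
  move: (k - n%:Z - 1) => l kl; rewrite kl in xxi *.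
  have degx := arity_bounds l x.
  (* The number of letters 2 that follow, cut at the length of the word of the
     last child. *)
  pose P (j : nat) := (xi (code_pos (l + 1) x + j%:Z) == 1%N) || (j == (arity l
      x).-1).
  have exP : exists j, P j by exists (arity l x).-1; rewrite /P eqxx orbT.
  case: (ex_minnP exP) => j Pj jmin.
  have jdeg : (j < arity l x)%N.
    by have := jmin (arity l x).-1; rewrite /P eqxx orbT => /(_ isT); lia.
  have [y Exy yj] := idx_surj jdeg.
  exists y => _; split=> // i iy; have {}iy : (i : int) < code_pos l y by [].
  have [ix|ix] := ltP i (code_pos (l + 1) x).
    rewrite -xxi//; apply: word_agree (_ : E (l + 1) y x) _.
      exact: (tower_sym tE).
    by rewrite -(code_pos_eq Exy).
  have := code_pos_step l y; rewrite -(code_pos_eq Exy) => posy.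
  have -> : i = code_pos (l + 1) y + `|i - code_pos (l + 1) y|%N%:Z.
    by rewrite -(code_pos_eq Exy); lia.
  set q := `|_|%N; have qlen : (q < code_len l y)%N.
    rewrite /q -(code_pos_eq Exy). lia.
  rewrite word_block// yj -(code_pos_eq Exy).
  case: (ltnP q j) => [qj|jq].
    case: (xi12 (code_pos (l + 1) x + q%:Z)) => // xiq.
    by have := jmin q; rewrite /P xiq eqxx => /(_ isT); lia.
  move: qlen; rewrite /code_len yj -(arity_parent Exy) => qlen.
  have {jq} qj : q = j by lia.
  by move: Pj; rewrite /P -qj => /orP[/eqP ->//|/eqP]; lia.
pose u := fix u n := if n is n.+1 then sval (cid (step n (u n))) else p.
have uxi n i : i < code_pos (k - n%:Z) (u n) -> word (u n) i = xi i.
  elim: n i => [|n IH]; last first.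
    by rewrite /=; case: cid => y /= /(_ IH)[].
  rewrite subr0 code_pos_base ?xi1; last exact: (tower_refl tE).
  move=> i ik; rewrite xi1; last by rewrite /k in ik; lia.
  rewrite /word; case: asboolP => // -[l].
  by rewrite idx_base; [lia|exact: (tower_refl tE)].
have uE n : E (k - n%:Z) (u n) (u n.+1).
  by rewrite /=; case: cid => y /= /(_ (uxi n))[].
have [x xu] := tower_complete tE uE.
exists x; apply/funext => i.
have [n ntop nik] : exists2 n : nat,
    k - n%:Z <= base_level x & i + k < n%:Z :> int.
  by exists (`|base_level x| + `|k| + `|i|).+1; lia.
have ix : i < code_pos (k - n%:Z) x.
  by have := code_pos_le x ntop;
      rewrite (code_pos_base (base_levelP (lexx _))); lia.
rewrite -(uxi n i).
  by apply: word_agree ix; apply: (tower_sym tE).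
by rewrite (code_pos_eq (xu n)).
Qed.

Definition meet k x y := E (k + 1) x y /\ ~ E k x y.

Lemma meet_exists x y : x != y -> exists k, meet k x y.
Proof.
move=> nxy; apply: contrapT => nmeet; move/eqP: nxy; apply.
suff down k : E (k + 1) x y -> E k x y.
  apply: (tower_separated tE) => k; have [l] := tower_join tE x y.
  have [lk|/ltW kl] := leP l k; first exact: tower_le.
  have -> : l = k + `|l - k|%N%:Z by lia.
  elim: `|l - k|%N => [|n IH]; first by rewrite addr0.
  by move=> Exy; apply/IH/down; have -> : k + n%:Z + 1 = k + n.+1%:Z by lia.
by move=> Exy; apply: contrapT => nExy; apply: nmeet; exists k.
Qed.

Lemma word_inj x y : word x = word y -> x = y.
Proof.
move=> wxy; apply/eqP/negPn/negP => /meet_exists[k [Exy nExy]].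
by have [j _] := word_differ Exy nExy; rewrite wxy.
Qed.

Lemma meet_lt k l x y : meet k x y -> E l x y -> k < l.
Proof.
by move=> [_ nExy] Exy; rewrite ltNge; apply/negP => lk;
    apply/nExy/(tower_le lk).
Qed.

Lemma code_pos_meet k x y : meet k x y ->
    code_pos (k + 1) x = code_pos (k + 1) y.
Proof. by case=> + _; exact: code_pos_eq. Qed.

(** In the intended use s is the logarithm of a cross-ratio in X, t that of the
cross-ratio of the images. *)
Definition squeezed (s t : int) :=
  (0 <= s -> s <= t <= N%:Z * s) /\ (s <= 0 -> N%:Z * s <= t <= s).

Lemma squeezedN s t : squeezed s t -> squeezed (- s) (- t).
Proof. by rewrite /squeezed mulrN => -[st ts]; split=> s0; lia. Qed.

Lemma squeezed_branch k l x :
    squeezed (l - k) (code_pos (k + 1) x - code_pos (l + 1) x).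
Proof.
have [kl|/ltW lk] := leP k l; split=> kl0.
- by have := @code_pos_le (k + 1) (l + 1) x; lia.
- have -> : k = l by lia.
  by rewrite !subrr mulr0.
- have -> : k = l by lia.
  by rewrite !subrr mulr0.
- by have := @code_pos_le (l + 1) (k + 1) x; rewrite !mulrBr; lia.
Qed.

(** The four points span a tree.  If a, e (or b, c) separate as high as a, c do,
two of the four levels cancel and the other two lie on one branch.  Otherwise
b, e separate at the level of a, c too, and the quantity is the sum of two
segments descending from that vertex, to where a, e separate and to where b, c
separate. *)
Lemma squeezed_cross_max k1 k2 k3 k4 a b c e :
  meet k1 a c -> meet k2 b e -> meet k3 a e -> meet k4 b c ->
  k2 <= k1 -> k3 <= k1 -> k4 <= k1 ->
  squeezed (k1 + k2 - k3 - k4)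
    (code_pos (k3 + 1) a + code_pos (k4 + 1) b
     - code_pos (k1 + 1) a - code_pos (k2 + 1) b).
Proof.
move=> m1 m2 m3 m4 k21 k31 k41.
have [k3E|nk3] := eqVneq k3 k1.
  rewrite k3E; have := squeezed_branch k4 k2 b; congr squeezed; lia.
have [k4E|nk4] := eqVneq k4 k1.
  rewrite (code_pos_meet m1) (code_pos_meet m2) (code_pos_meet m3)
      (code_pos_meet m4).
  rewrite k4E; have := squeezed_branch k3 k2 e; congr squeezed; lia.
have Eae : E k1 a e by case: m3 => + _; apply: tower_le; lia.
have Ebc : E k1 b c by case: m4 => + _; apply: tower_le; lia.
have k2E : k2 = k1.
  apply/eqP; rewrite eq_le k21 leNgt; apply/negP => lt21.
  case: m1 => _; apply; apply: (tower_trans tE Eae).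
  apply: (tower_trans tE _ Ebc); apply: (tower_sym tE).
  by case: m2 => + _; apply: tower_le; lia.
have -> : code_pos (k2 + 1) b = code_pos (k1 + 1) a.
  rewrite k2E (code_pos_eq (tower_coarsen tE Ebc)); apply/esym/code_pos_eq.
  by case: m1.
have [+ _] := squeezed_branch k3 k1 a; have [+ _] := squeezed_branch k4 k1 b.
rewrite k2E (code_pos_eq (tower_coarsen tE Ebc)).
rewrite -(code_pos_meet m1).
by rewrite /squeezed !mulrBr mulrDr; lia.
Qed.

(** The symmetries of the cross-ratio, which preserve or negate its logarithm,
put the largest of the four levels first. *)
Lemma squeezed_cross k1 k2 k3 k4 a b c e :
  meet k1 a c -> meet k2 b e -> meet k3 a e -> meet k4 b c ->
  squeezed (k1 + k2 - k3 - k4)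
    (code_pos (k3 + 1) a + code_pos (k4 + 1) b
     - code_pos (k1 + 1) a - code_pos (k2 + 1) b).
Proof.
move=> m1 m2 m3 m4.
have transport s t s' t' : squeezed s' t' -> s = s' -> t = t' -> squeezed s t.
  by move=> + -> ->.
have [h1|nh1] := boolP ((k2 <= k1) && (k3 <= k1) && (k4 <= k1)).
  by apply: squeezed_cross_max m1 m2 m3 m4 _ _ _; lia.
have [h2|nh2] := boolP ((k1 <= k2) && (k3 <= k2) && (k4 <= k2)).
  by apply: transport (squeezed_cross_max m2 m1 m4 m3 _ _ _) _ _; lia.
have [h3|nh3] := boolP ((k1 <= k3) && (k2 <= k3) && (k4 <= k3)).
  by apply: transport (squeezedN (squeezed_cross_max m3 m4 m1 m2 _ _ _)) _ _;
      lia.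
by apply: transport (squeezedN (squeezed_cross_max m4 m3 m2 m1 _ _ _)) _ _; lia.
Qed.

End coding.

(** * A self-homeomorphism of the half-line made of powers and roots *)

Section gauge.
Context {R : realType}.
Implicit Types (x y : R) (j : nat).

(** The root of order 2^j, as an iterated square root: its continuity and its
inverse come from those of the square root. *)
Definition isqrt j : R -> R := iter j Num.sqrt.
Definition isqr j : R -> R := iter j (fun x => x ^+ 2).

Lemma isqrt_ge0 j x : 0 <= x -> 0 <= isqrt j x.
Proof. by move=> x0; case: j => //= j; exact: sqrtr_ge0. Qed.

Lemma isqrE j x : isqr j x = x ^+ (2 ^ j).
Proof.
by elim: j => [|j IH] /=; rewrite ?expr1// IH -exprM expnSr.
Qed.

Lemma isqr_ge0 j x : 0 <= x -> 0 <= isqr j x.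
Proof. by rewrite isqrE; exact: exprn_ge0. Qed.

Lemma isqrK j x : 0 <= x -> isqrt j (isqr j x) = x.
Proof.
move=> x0; elim: j => // j IH.
by rewrite /isqrt iterSr /= sqrtr_sqr ger0_norm ?isqr_ge0.
Qed.

Lemma isqrtK j x : 0 <= x -> isqr j (isqrt j x) = x.
Proof.
move=> x0; elim: j => // j IH.
by rewrite /isqr iterSr /= sqr_sqrtr ?isqrt_ge0.
Qed.

Lemma isqrt_continuous j : continuous (isqrt j).
Proof.
elim: j => [|j IH] x /=; first exact: cvg_id.
by apply: (@continuous_comp _ _ _ (isqrt j) Num.sqrt);
  [exact: IH|exact: sqrt_continuous].
Qed.

Lemma isqr_continuous j : continuous (isqr j).
Proof.
move=> x; rewrite (_ : isqr j = fun x => x ^+ (2 ^ j));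
    first exact: exprn_continuous.
by apply/funext => y; rewrite isqrE.
Qed.

Lemma isqrt_le j : {homo isqrt j : x y / x <= y}.
Proof. by elim: j => //= j IH x y /IH; exact: ler_wsqrtr. Qed.

Lemma isqr_ge1 j x : 1 <= x -> x <= isqr j x.
Proof. by rewrite isqrE; apply: ler_eXnr; rewrite expn_gt0. Qed.

Lemma isqr_le1 j x : 0 <= x <= 1 -> isqr j x <= x.
Proof.
by rewrite isqrE => /andP[x0 x1]; apply: ler_iXnr => //; rewrite expn_gt0.
Qed.

Lemma isqrt1 j : isqrt j 1 = 1.
Proof. by have := @isqrK j 1 ler01; rewrite isqrE expr1n. Qed.

Lemma isqrt_ge1 j x : 1 <= x -> 1 <= isqrt j x <= x.
Proof.
move=> x1; have := isqrt_le j x1; rewrite isqrt1 => q1.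
rewrite q1/= -[leRHS](@isqrtK j)//; last by lra.
exact: isqr_ge1.
Qed.

Lemma isqrt_le1 j x : 0 <= x <= 1 -> x <= isqrt j x <= 1.
Proof.
move=> /andP[x0 x1]; have := isqrt_le j x1; rewrite isqrt1 => q1.
rewrite q1 andbT -[leLHS](@isqrtK j)//.
by apply: isqr_le1; rewrite isqrt_ge0// q1.
Qed.

(** The larger of the power and the root of order 2^j, that is the power above 1
and the root below 1.  The inverse function is the smaller of the two. *)
Definition gauge j x := Num.max (isqrt j x) (isqr j x).
Definition gauge_inv j x := Num.min (isqrt j x) (isqr j x).

Lemma gauge_ge1 j x : 1 <= x ->
    gauge j x = isqr j x /\ gauge_inv j x = isqrt j x.
Proof.
move=> x1; have := isqr_ge1 j x1; have /andP[_ sx] := isqrt_ge1 j x1 => qx.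
have sq : isqrt j x <= isqr j x by apply: le_trans qx.
by rewrite /gauge /gauge_inv max_r// min_l.
Qed.

Lemma gauge_le1 j x : 0 <= x <= 1 ->
    gauge j x = isqrt j x /\ gauge_inv j x = isqr j x.
Proof.
move=> x1; have := isqr_le1 j x1; have /andP[sx _] := isqrt_le1 j x1 => qx.
have sq : isqr j x <= isqrt j x by apply: le_trans sx.
by rewrite /gauge /gauge_inv max_l// min_r.
Qed.

Lemma gaugeK j x : 0 <= x -> gauge_inv j (gauge j x) = x.
Proof.
move=> x0; have [x1|/ltW x1] := leP 1 x.
  have [-> _] := gauge_ge1 j x1.
  by rewrite (gauge_ge1 j (le_trans x1 (isqr_ge1 j x1))).2 isqrK.
have x01 : 0 <= x <= 1 by rewrite x0.
have [-> _] := gauge_le1 j x01; rewrite (gauge_le1 j _).2 ?isqrtK//.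
by rewrite isqrt_ge0//=; case/andP: (isqrt_le1 j x01).
Qed.

Lemma gauge_invK j x : 0 <= x -> gauge j (gauge_inv j x) = x.
Proof.
move=> x0; have [x1|/ltW x1] := leP 1 x.
  have [_ ->] := gauge_ge1 j x1; rewrite (gauge_ge1 j _).1 ?isqrtK//.
  by case/andP: (isqrt_ge1 j x1).
have x01 : 0 <= x <= 1 by rewrite x0.
have [_ ->] := gauge_le1 j x01; rewrite (gauge_le1 j _).1 ?isqrK//.
by rewrite isqr_ge0//= (le_trans (isqr_le1 j x01)).
Qed.

Lemma gauge_ge0 j x : 0 <= x -> 0 <= gauge j x.
Proof. by move=> x0; rewrite le_max isqrt_ge0. Qed.

Lemma gauge_inv_ge0 j x : 0 <= x -> 0 <= gauge_inv j x.
Proof. by move=> x0; rewrite le_min isqrt_ge0// isqr_ge0. Qed.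

Lemma gauge_le j x y : 0 <= x -> x <= y -> gauge j x <= gauge j y.
Proof.
move=> x0 xy; rewrite /gauge ge_max !le_max isqrt_le//= !isqrE.
by rewrite [X in _ || X]lerXn2r ?orbT ?nnegrE// (le_trans x0).
Qed.

Lemma gauge_continuous j : continuous (gauge j).
Proof.
move=> x; apply: continuous_max;
    [exact: isqrt_continuous|exact: isqr_continuous].
Qed.

Lemma gauge_inv_continuous j : continuous (gauge_inv j).
Proof.
move=> x; apply: continuous_min;
    [exact: isqrt_continuous|exact: isqr_continuous].
Qed.

Lemma gauge_homeo j (A K : R) : 0 < A -> 0 < K ->
  @homeomorphism_on R R `[0, +oo[ `[0, +oo[ (fun x => A * gauge j (K * x)).
Proof.
move=> A0 K0.
have rescaled (a k : R) (f : R -> R) : continuous f ->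
    continuous (fun x => a * f (k * x)).
  move=> fc x; apply: cvgM; first exact: cvg_cst.
  apply: (@continuous_comp _ _ _ ( *%R k) f); last exact: fc.
  exact: mulrl_continuous.
split.
- by apply: continuous_subspaceT; apply: rescaled; exact: gauge_continuous.
- move=> x /=; rewrite !in_itv/= !andbT => x0.
  by rewrite mulr_ge0 ?(ltW A0)// gauge_ge0// mulr_ge0// ltW.
exists (fun x => K^-1 * gauge_inv j (A^-1 * x)); split.
- by apply: continuous_subspaceT; apply: rescaled; exact: gauge_inv_continuous.
- move=> x /=; rewrite !in_itv/= !andbT => x0.
  by rewrite mulr_ge0 ?invr_ge0 ?(ltW K0)// gauge_inv_ge0// mulr_ge0// invr_ge0
      ltW.
- move=> x; rewrite inE/= in_itv/= andbT => x0.
  by rewrite mulKf ?gt_eqF// gaugeK ?mulKf ?gt_eqF// mulr_ge0// ltW.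
- move=> x; rewrite inE/= in_itv/= andbT => x0.
  rewrite mulVKf ?gt_eqF// gauge_invK ?mulVKf ?gt_eqF//.
  by rewrite mulr_ge0 ?invr_ge0// ltW.
Qed.

(** A squeezed pair is dominated by the gauge: above 1 the factor N in the
exponent is absorbed by the power, and below 1 the ratio w between the
exponents of the base 2^w and of the base 2 is absorbed by the root. *)
Lemma gauge_ge j (N w : nat) (s t : int) : (N <= 2 ^ j)%N -> (w <= 2 ^ j)%N ->
  (0 < w)%N -> squeezed N s t ->
  2 ^ t <= gauge j ((2 ^+ w) ^ s) :> R.
Proof.
move=> Nj wj w0 [s0 s1].
have two (u v : int) : u <= v -> 2 ^ u <= 2 ^ v :> R.
  by move=> uv; rewrite ler_eXz2l// ltr1n.
have qE : (2 ^+ w : R) ^ s = 2 ^ (w%:Z * s) by rewrite exprnP exprz_exp.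
rewrite qE; have [s_ge0|/ltW s_le0] := leP 0 s.
  rewrite (gauge_ge1 j _).1; last by rewrite -(expr0z (2 : R)); apply: two; lia.
  rewrite isqrE exprnP exprz_exp; apply: two.
  have /andP[_ tN] := s0 s_ge0; apply: (le_trans tN).
  have : N%:Z * s <= (2 ^ j)%N%:Z * s by apply: ler_wpM2r => //; lia.
  by move: (2 ^ j)%N => n Nn; nia.
rewrite (gauge_le1 j _).1; last first.
  by rewrite exprz_ge0//= -(expr0z (2 : R)); apply: two; nia.
apply: (@le_trans _ _ (2 ^ s)); first by apply: two; have := s1 s_le0; lia.
rewrite -[leLHS](@isqrK j) ?exprz_ge0//; apply: isqrt_le.
rewrite isqrE exprnP exprz_exp; apply: two.
by move: (2 ^ j)%N wj => n wn; nia.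
Qed.

End gauge.

(** * Uniformization of complete, doubling,
    uniformly perfect and uniformly disconnected spaces *)

Section metric_notions.
Context {R : realType} (X : metricType R).
Implicit Types (x y : X) (r s : R).

(** Some chain from x to y has all its steps shorter than s: y lies in every set
that contains x and is stable under such steps. *)
Definition chained s x y := forall A : set X, A x ->
  (forall u v, A u -> mdist u v < s -> A v) -> A y.

Definition uniformly_disconnected (delta : R) := forall r x y, 0 < r ->
  chained (delta * r) x y -> mdist x y <= r.

Definition uniformly_perfect (C : R) := forall r x, 0 < r ->
  exists y, r < mdist x y <= C * r.

(** Stated through separated families, which is the form in which it bounds the
number of children of a class. *)
Definition doubling := forall rho : R, 0 < rho -> exists N : nat,
  forall r x (s : seq X), 0 < r -> (forall y, y \in s -> mdist x y <= r) ->
  (forall i j, (i < j < size s)%N ->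
      rho * r <= mdist (nth x s i) (nth x s j)) ->
  (size s <= N)%N.

Definition cauchy_complete := forall u : nat -> X,
  (forall e : R, 0 < e -> exists n, forall m, (n <= m)%N ->
      mdist (u n) (u m) < e) ->
  exists l, forall e : R, 0 < e -> exists n, forall m, (n <= m)%N ->
      mdist (u m) l < e.

Lemma chained_refl s x : chained s x x.
Proof. by []. Qed.

Lemma chained_trans s y x z : chained s x y -> chained s y z -> chained s x z.
Proof. by move=> xy yz A Ax AS; exact: yz (xy _ Ax AS) AS. Qed.

Lemma chained_step s x y : mdist x y < s -> chained s x y.
Proof. by move=> xys A Ax AS; exact: AS xys. Qed.

Lemma chained_sym s x y : chained s x y -> chained s y x.
Proof.
move=> xy; refine (xy [set z | chained s z x] _ _) => [|u v /= ux uv].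
  exact: chained_refl.
by apply: chained_trans ux; apply: chained_step; rewrite metric_sym.
Qed.

Lemma chained_le s t x y : s <= t -> chained s x y -> chained t x y.
Proof.
by move=> st xy A Ax AS; apply: xy => // u v Au uv; apply: (AS u) => //;
    apply: lt_le_trans st.
Qed.

End metric_notions.

Lemma exists_pow_gt {R : realType} (M a : R) : 2 <= M ->
    exists n : nat, a < M ^+ n.
Proof.
move=> M2; set n := Num.bound `|a|; exists n.
apply: (@lt_le_trans _ _ n%:R).
  by apply: le_lt_trans (ler_norm a) _; exact: archi_boundP.
apply: (@le_trans _ _ (2 ^+ n)); last by apply: lerXn2r => //; rewrite nnegrE;
    lra.
by rewrite -natrX ler_nat ltnW// ltn_expl.
Qed.

Lemma exists_pow_lt {R : realType} (M e : R) : 2 <= M -> 0 < e ->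
  exists n : nat, M ^ (- n%:Z) < e.
Proof.
move=> M2 e0; have [n en] := exists_pow_gt e^-1 M2; exists n.
by rewrite -exprnN invf_plt ?posrE// exprn_gt0//; lra.
Qed.

Section uniformization.
Context {R : realType} (X : metricType R) (p : X) (delta C : R).
Hypotheses (delta0 : 0 < delta) (disc : uniformly_disconnected X delta)
  (perf : uniformly_perfect X C) (dbl : doubling X) (cpl : cauchy_complete X).
Context (w : nat).
(* A power of 2, so that a level of the tower shifts the exponent of 2 by w. *)
Let M : R := 2 ^+ w.
Hypotheses (w0 : (0 < w)%N) (CM : C < delta * M).

Let M2 : 2 <= M.
Proof.
by rewrite /M; case: w w0 => // n _; rewrite exprS ler_peMr// exprn_ege1//; lra.
Qed.

Let M0 : 0 < M. Proof. by apply: lt_le_trans M2. Qed.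

Let Mexp k : 0 < M ^ k. Proof. by rewrite exprz_gt0. Qed.

Let MS k : M ^ (k + 1) = M * M ^ k.
Proof. by rewrite expfzDr ?gt_eqF// expr1z mulrC. Qed.

Let Mle k l : k <= l -> M ^ k <= M ^ l.
Proof. by move=> kl; rewrite ler_weXz2l// (le_trans _ M2)// ler1n. Qed.

(** Being joined by chains of steps shorter than delta M^k is an equivalence
relation and coarsens with k; uniform disconnectedness keeps its classes small,
so it replaces a comparable ultrametric. *)
Definition scale_class k (x y : X) := chained (delta * M ^ k) x y.

Lemma scale_class_le k x y : scale_class k x y -> mdist x y <= M ^ k.
Proof. exact: disc. Qed.

Lemma not_scale_class k x y : ~ scale_class k x y -> delta * M ^ k <= mdist x y.
Proof. by move=> nxy; rewrite leNgt; apply/negP => /chained_step. Qed.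

(** A class splits because a point at distance between M^k and C M^k can be
reached by one step of the next level, delta M exceeding C, but is too far to be
in the same class of level k. *)
Lemma scale_tower : exists N, partition_tower scale_class N.
Proof.
have [N NP] := dbl (divr_gt0 delta0 M0); exists N.
have mono k l x y : k <= l -> scale_class k x y -> scale_class l x y.
  by move=> kl; apply: chained_le; rewrite ler_pM2l// Mle.
split.
- by move=> k x; exact: chained_refl.
- by move=> k x y; exact: chained_sym.
- by move=> k y x z; exact: chained_trans.
- by move=> k x y; apply: mono; lia.
- move=> k x; have [y /andP[ky yk]] := perf x (Mexp k); exists y.
    apply: chained_step; apply: le_lt_trans yk _; rewrite MS mulrA.
    by rewrite ltr_pM2r.
  by move=> /scale_class_le; rewrite leNgt ky.
- move=> k x s sx sn; apply: (NP (M ^ (k + 1)) x) => //.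
    by move=> y /sx/scale_class_le.
  move=> i j /sn/not_scale_class; rewrite MS mulrA divfK ?gt_eqF//.
- move=> x y; have [n xyn] := exists_pow_gt (mdist x y / delta) M2.
  by exists n%:Z; apply: chained_step; rewrite mulrC -ltr_pdivrMr.
- move=> x y xy; apply/eqP/negPn/negP; rewrite -mdist_gt0 => xy0.
  have [n] := exists_pow_lt M2 xy0.
  by rewrite ltNge (scale_class_le (xy _)).
move=> k u uE.
have far n m : scale_class (k - n%:Z) (u n) (u (n + m)%N).
  elim: m => [|m IH]; first by rewrite addn0; exact: chained_refl.
  rewrite addnS; apply: chained_trans IH _;
      apply: (@mono (k - (n + m)%N%:Z)) => //.
  lia.
have [|l ul] := @cpl u.
  move=> e e0; have ek : 0 < e / M ^ k by rewrite divr_gt0.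
  have [n ne] := exists_pow_lt M2 ek; exists n => m nm.
  have := far n (m - n)%N; rewrite subnKC// => /scale_class_le/le_lt_trans;
      apply.
  by rewrite expfzDr ?gt_eqF// mulrC -ltr_pdivlMr.
exists l => n; have [m ml] :=
    ul (delta * M ^ (k - n%:Z)) (mulr_gt0 delta0 (Mexp _)).
apply: chained_trans (far n m) _; apply: chained_step.
by apply: ml; exact: leq_addl.
Qed.

Section tower.
Context (N : nat) (tE : partition_tower scale_class N).

Definition coding (x : X) : C2 R := SigSub (mem_set (word_C2 p tE x)).

Lemma coding_seq x : C2_seq (coding x) = word p tE x.
Proof. by []. Qed.

Lemma coding_inj : injective coding.
Proof. by move=> x y /(congr1 C2_seq); exact: word_inj. Qed.

Lemma coding_surj xi : exists x, coding x = xi.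
Proof.
have [x xE] := word_surj p tE (set_valP xi).
by exists x; apply: val_inj.
Qed.

Lemma meet_mdist k x y : meet scale_class k x y ->
  delta * M ^ k <= mdist x y <= M * M ^ k.
Proof.
by move=> [/scale_class_le + /not_scale_class ->]; rewrite MS.
Qed.

(** The codes agree up to the end of the last common word and differ within the
next one, which has at most N letters. *)
Lemma meet_rho2 k x y : meet scale_class k x y ->
  2 ^ (- code_pos p tE (k + 1) x - N%:Z) <= mdist (coding x) (coding y)
    <= 2 ^ (1 - code_pos p tE (k + 1) x).
Proof.
move=> [Exy nExy].
have xy : coding x != coding y.
  by apply/eqP => /coding_inj xy; apply: nExy; rewrite xy; exact: chained_refl.
have [m [dE magree mdiffer]] := rho2P xy.
have -> : mdist (coding x) (coding y) = 2 ^ (- m) by [].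
have [j jN wj] := word_differ p tE Exy nExy.
have mj : m < code_pos p tE (k + 1) x + j%:Z.
  by rewrite ltNge; apply/negP => /magree.
have hm : code_pos p tE (k + 1) x <= m + 1.
  rewrite leNgt; apply/negP => hm; move/eqP: mdiffer; apply.
  by rewrite !coding_seq; apply: word_agree Exy hm.
by apply/andP; split; rewrite ler_weXz2l ?ler1n//; lia.
Qed.

Lemma coding_small k x y : scale_class k x y ->
  mdist (coding x) (coding y) <= 2 ^ (1 - code_pos p tE k x) :> R.
Proof.
move=> Exy; have [->|/(meet_exists tE)[l lxy]] := eqVneq x y.
  by rewrite mdistxx exprz_ge0.
have /andP[_ /le_trans] := meet_rho2 lxy; apply; rewrite ler_weXz2l ?ler1n//.
have lk : l + 1 <= k by have := meet_lt tE lxy Exy; lia.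
by have := code_pos_le p tE x lk; lia.
Qed.

Lemma coding_close k x y :
  mdist (coding x) (coding y) < 2 ^ (- code_pos p tE k x - N%:Z) :> R ->
  mdist x y <= M ^ k.
Proof.
have [->|/(meet_exists tE)[l lxy]] := eqVneq x y; first by move=> _;
    rewrite mdistxx ltW.
have /andP[lo _] := meet_rho2 lxy => /(le_lt_trans lo).
rewrite ltr_eXz2l ?ltr1n// => lk.
have {}lk : l + 1 < k by apply: (@code_pos_mono _ _ _ p tE _ _ x); lia.
have /andP[_ /le_trans] := meet_mdist lxy; apply; rewrite -MS.
by apply: Mle; lia.
Qed.

Lemma coding_homeo : homeomorphism coding.
Proof.
pose g xi := sval (cid (coding_surj xi)).
have gK xi : coding (g xi) = xi by rewrite /g; case: cid.
have Kg x : g (coding x) = x by apply: coding_inj.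
split => //.
  apply: continuous_subspaceT => x.
  apply/metricType_numDomainType.cvgrPdist_lt => e e0.
  have [n ne] := exists_pow_lt (lexx 2) e0.
  pose k := - (`|base_level p tE x| + n + 1)%N%:Z.
  have hk : n%:Z + 1 <= code_pos p tE k x.
    have kt : k <= base_level p tE x by lia.
    have := code_pos_le p tE x kt;
        rewrite (code_pos_base tE (base_levelP (lexx _))).
    by rewrite /k; lia.
  apply/metricType_numDomainType.nbhs_mdistP.
  exists (delta * M ^ k) => [|y /= xy]; first by rewrite /= mulr_gt0.
  apply: le_lt_trans ne; apply: le_trans (coding_small (chained_step xy)) _.
  by rewrite ler_weXz2l ?ler1n//; lia.
exists g; split=> //.
apply: continuous_subspaceT => xi.
apply/(@metricType_numDomainType.cvgrPdist_lt _ _ _ _ (nbhs_filter xi)) => e e0.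
have [n ne] := exists_pow_lt M2 e0.
apply/(@metricType_numDomainType.nbhs_mdistP R (C2 R)).
exists (2 ^ (- code_pos p tE (- n%:Z) (g xi) - N%:Z)) => [|zeta /= xz].
  by rewrite /= exprz_gt0.
by apply: le_lt_trans ne; apply: coding_close; rewrite !gK.
Qed.

(** Replacing each distance by a power of M, or of 2, costs a constant factor
and turns the two cross-ratios into M^s and 2^t with (s, t) squeezed. *)
Lemma coding_cross_ratio : exists A K j, [/\ 0 < A, 0 < K &
  forall a b c e : X, uniq [:: a; b; c; e] ->
    cross_ratio (coding a) (coding b) (coding c) (coding e) <=
      A * gauge j (K * cross_ratio a b c e)].
Proof.
(* Two factors above and two below lose (M / delta)^2 together in X, and
   2^(2 N + 2) in C_2; the exponent 2^j of the gauge must be at least N and w.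
       *)
exists (2 ^ (2 * N%:Z + 2)), ((M / delta) ^+ 2), (maxn N w).
split; [by rewrite exprz_gt0|by rewrite exprn_gt0// divr_gt0|].
move=> a b c e; rewrite /= !inE !negb_or.
move=> /and4P[/and3P[ab ac ae] /andP[bc be] ce _].
have [k1 m1] := meet_exists tE ac; have [k2 m2] := meet_exists tE be.
have [k3 m3] := meet_exists tE ae; have [k4 m4] := meet_exists tE bc.
have sq := squeezed_cross p tE m1 m2 m3 m4.
set s := k1 + k2 - k3 - k4 in sq; set t := _ - code_pos _ _ _ b in sq.
have Nj : (N <= 2 ^ maxn N w)%N.
  by apply: leq_trans (ltnW (ltn_expl _ _)) => //; exact: leq_maxl.
have wj : (w <= 2 ^ maxn N w)%N.
  by apply: leq_trans (ltnW (ltn_expl _ _)) => //; exact: leq_maxr.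
have gle := gauge_ge (R := R) Nj wj w0 sq.
have cr : M ^ s <= (M / delta) ^+ 2 * cross_ratio a b c e.
  have /andP[l1 _] := meet_mdist m1; have /andP[l2 _] := meet_mdist m2.
  have /andP[l3 u3] := meet_mdist m3; have /andP[l4 u4] := meet_mdist m4.
  rewrite /cross_ratio /s.
  have p3 : 0 < mdist a e by rewrite mdist_gt0.
  have p4 : 0 < mdist b c by rewrite mdist_gt0.
  rewrite mulrA ler_pdivlMr ?mulr_gt0//.
  apply: (@le_trans _ _ (M ^ s * ((M * M ^ k3) * (M * M ^ k4)))).
    by rewrite ler_pM2l// ler_pM// ltW.
  have -> : M ^ s * (M * M ^ k3 * (M * M ^ k4)) =
      (M / delta) ^+ 2 * ((delta * M ^ k1) * (delta * M ^ k2)).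
    have -> : M ^ s = M ^ k1 * M ^ k2 / M ^ k3 / M ^ k4.
      by rewrite /s !expfzDr ?gt_eqF// -!invr_expz.
    field; rewrite ?gt_eqF//.
  rewrite ler_pM2l ?exprn_gt0 ?divr_gt0// ler_pM// ltW// mulr_gt0//.
apply: (@le_trans _ _ (2 ^ (2 * N%:Z + 2) * 2 ^ t)); last first.
  rewrite ler_pM2l ?exprz_gt0//; apply: (le_trans gle); apply: gauge_le cr.
  by rewrite ltW.
rewrite /cross_ratio.
have /andP[_ u1] := meet_rho2 m1; have /andP[_ u2] := meet_rho2 m2.
have /andP[l3 _] := meet_rho2 m3; have /andP[l4 _] := meet_rho2 m4.
have P3 : 0 < mdist (coding a) (coding e) by apply: lt_le_trans l3;
    rewrite exprz_gt0.
have P4 : 0 < mdist (coding b) (coding c) by apply: lt_le_trans l4;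
    rewrite exprz_gt0.
rewrite ler_pdivrMr ?mulr_gt0//.
apply: (le_trans (ler_pM _ _ u1 u2)); rewrite ?mdist_ge0//.
apply: le_trans (ler_wpM2l _ (ler_pM _ _ l3 l4));
    rewrite ?mulr_ge0 ?exprz_ge0//.
rewrite -!expfzDr ?pnatr_eq0//.
rewrite ler_weXz2l ?ler1n//; rewrite /t.
by clear; lia.
Qed.

End tower.

(** The unbounded case of the uniformization theorem of David and Semmes for
Cantor sets. *)
Theorem uniformization : exists f : X -> C2 R, quasi_moebius f.
Proof.
have [N tE] := scale_tower; exists (coding tE); split;
    first exact: coding_homeo.
have [A [K [j [A0 K0 crP]]]] := coding_cross_ratio tE.
exists (fun x => A * gauge j (K * x)); first exact: gauge_homeo.
exact: crP.
Qed.

End uniformization.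

(** * Inversions at every point and the geometry they force *)

Section invertible_homogeneous.
Context {R : realType} (X : metricType R).
Local Notation d := (@mdist R X).
Implicit Types (x y z u v p q : X) (A U V P Q : set X) (c : R).

(** The inverse map is part of the data, so that images under f are preimages
under f'. *)
Definition bilipschitz c (f f' : X -> X) := [/\ cancel f f', cancel f' f &
  forall u v, d (f u) (f v) <= c * d u v /\ d u v <= c * d (f u) (f v)].

(** The distance estimates are those of a quasi-inversion with denominators
cleared.  The third clause is the continuity of tau' away from q. *)
Definition inversion c q (tau tau' : X -> X) := [/\
  forall x, x != q -> tau x != q /\ tau' (tau x) = x,
  forall x, x != q -> tau' x != q /\ tau (tau' x) = x,
  forall U, open U -> ~ U q -> open (tau @` U)
  & forall u v, u != q -> v != q ->
      d (tau u) (tau v) * (d u q * d v q) <= c * d u v /\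
      d u v <= c * (d (tau u) (tau v) * (d u q * d v q))].

Lemma openP A : open A <-> forall x, A x ->
    exists2 e : R, 0 < e & forall y, d x y < e -> A y.
Proof.
rewrite openE; split=> [Ao x /Ao|Ae x /Ae[e e0 eA]].
  by move/metricType_numDomainType.nbhs_mdistP => [e e0 eA]; exists e.
by apply/metricType_numDomainType.nbhs_mdistP; exists e.
Qed.

Lemma open_setD1 A x : open A -> open (A `\ x).
Proof.
move=> Ao; apply: openI => //; apply/openP => y /= /eqP yx.
exists (d y x) => [|z + zx]; first by rewrite mdist_gt0.
by rewrite zx ltxx.
Qed.

Lemma setD1_notin A x : ~ (A `\ x) x.
Proof. by move=> [_]; apply. Qed.

Lemma setCU1 A x : ~` (A `|` [set x]) = ~` A `\ x.
Proof. by rewrite setCU. Qed.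

Lemma bilipschitz_open c f f' A : 0 < c -> bilipschitz c f f' -> open A ->
    open (f @` A).
Proof.
move=> c0 [fK f'K fE] /openP Ao; apply/openP => _ [x /Ao[e e0 eA] <-].
exists (e / c) => [|y xy]; first by rewrite divr_gt0.
exists (f' y) => //; apply: eA; have [_] := fE x (f' y); rewrite f'K.
by move=> /le_lt_trans; apply; rewrite mulrC -ltr_pdivlMr.
Qed.

Definition mbounded A := exists x0 B, forall x, A x -> d x0 x <= B.

Lemma mboundedP A x : mbounded A -> exists2 B, 0 < B & forall y, A y ->
    d x y <= B.
Proof.
move=> [x0 [B AB]]; exists (`|d x x0 + B| + 1) => [|y /AB yB];
    first by rewrite ltr_wpDl.
have := metric_triangle x x0 y; have := ler_norm (d x x0 + B); lra.
Qed.

Lemma mboundedU A A' : mbounded A -> mbounded A' -> mbounded (A `|` A').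
Proof.
move=> [x [B AB]] /(mboundedP x)[B' _ AB']; exists x, (Num.max B B').
by move=> y [/AB|/AB'] yB; rewrite le_max yB ?orbT.
Qed.

Lemma mboundedS A A' : A `<=` A' -> mbounded A' -> mbounded A.
Proof. by move=> AA' [x [B AB]]; exists x, B => y /AA'/AB. Qed.

Lemma mbounded1 x : mbounded [set x].
Proof. by exists x, 0 => _ ->; rewrite mdistxx. Qed.

Context (c : R).
Hypotheses (c1 : 1 <= c)
  (hom : forall x y, exists f f', bilipschitz c f f' /\ f x = y)
  (inv : forall q, exists tau tau', inversion c q tau tau')
  (unb : forall B : R, exists x y, B < d x y).

Let c0 : 0 < c. Proof. by apply: lt_le_trans c1. Qed.

Lemma far_point x (B : R) : exists y, B < d x y.
Proof.
have [y [z yz]] := unb (2 * B); have := metric_triangle y x z.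
rewrite (metric_sym y x); have [xy|xy] := ltP B (d x y); first by exists y.
by exists z; lra.
Qed.

Lemma inversion_complement q tau tau' A : inversion c q tau tau' ->
  ~ A q -> ~` (tau @` A) `\ q = tau @` (~` A `\ q).
Proof.
move=> [tK t'K _ _] Aq; apply/seteqP; split=> y /=.
  move=> [nAy /eqP yq]; have [t'yq ty] := t'K y yq.
  exists (tau' y) => //; split; last exact/eqP.
  by move=> At'y; apply: nAy; exists (tau' y).
move=> [x [nAx /eqP xq] <-]; have [txq t'x] := tK x xq; split; last exact/eqP.
move=> [x' Ax' tx']; apply: nAx; have x'q : x' != q by apply/eqP => e;
    rewrite e in Ax'.
by have [_ t'x'] := tK x' x'q; rewrite -t'x -tx' t'x'.
Qed.

(** Away from q the reciprocals of the distances to q are bounded, and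
d(u, v) / (d(u, q) d(v, q)) is at most 1 / d(u, q) + 1 / d(v, q). *)
Lemma inversion_bounded q tau tau' A (e : R) : inversion c q tau tau' ->
    0 < e ->
  (forall x, A x -> e <= d x q) -> mbounded (tau @` A).
Proof.
move=> [_ _ _ tE] e0 Ae.
have [[a Aa]|nA] := pselect (exists a, A a); last first.
  by have [x [y xy]] := unb 0; exists x, 0 => z [a Aa _]; case: nA; exists a.
have neq x : A x -> x != q by move=> /Ae xe;
    rewrite -mdist_gt0 (lt_le_trans e0).
exists (tau a), (2 * c / e) => _ [x Ax <-].
have [+ _] := tE a x (neq a Aa) (neq x Ax).
have := Ae _ Aa; have := Ae _ Ax; have := metric_triangle a q x.
rewrite (metric_sym q x); set m := d a q; set n := d x q;
    set D := d _ _ => mn nE mE H.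
rewrite ler_pdivlMr//.
have mn0 : 0 < m * n by rewrite mulr_gt0//; lra.
have : D * (m * n) <= c * (m + n) by apply: (le_trans H); rewrite ler_pM2l//.
move=> K; rewrite -(ler_pM2r mn0); apply: (@le_trans _ _ (e * (c * (m + n)))).
  have -> : D * e * (m * n) = e * (D * (m * n)) by ring.
  by rewrite ler_pM2l.
have : e * m <= n * m by rewrite ler_pM2r//; lra.
have : e * n <= m * n by rewrite ler_pM2r//; lra.
move=> h1 h2; have : c * (e * m + e * n) <= c * (n * m + m * n)
    by rewrite ler_pM2l//; lra.
move=> h; lra.
Qed.

Section distances.

Definition is_distance (D : R) := 0 < D /\ exists x y, d x y = D.

(** By homogeneity, every point sees every distance of X, up to a constant. *)
Lemma distance_from D x : is_distance D ->
    exists q, D <= c * d x q /\ d x q <= c * D.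
Proof.
have c_ge1 := c1; have c_gt0 := c0.
move=> [D0 [a [b abD]]]; have [f [f' [[fK f'K fE] fa]]] := hom a x.
by exists (f b); rewrite -fa -abD; have [] := fE a b.
Qed.

(** Take x at distance D from q and y much further away: then d(x, y) and
d(y, q) are comparable and cancel, so the inversion at q puts x and y at a
distance comparable to 1 / D. *)
Lemma distance_inv D : is_distance D ->
  exists2 D', is_distance D' & 1 <= 2 * c * (D * D') /\ D * D' <= 2 * c.
Proof.
have c_ge1 := c1; have c_gt0 := c0.
move=> [D0 [x [q xqD]]]; have [tau [tau' [_ _ _ tE]]] := inv q.
have [y qy] := far_point q (2 * D); rewrite metric_sym in qy.
have xq : x != q by rewrite -mdist_gt0 xqD.
have yq : y != q by rewrite -mdist_gt0; lra.
have [] := tE x y xq yq; rewrite xqD.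
have := metric_triangle x q y; have := metric_triangle y x q.
rewrite (metric_sym y x) (metric_sym q y) xqD.
set n := d y q in qy *; set m := d x y; set D' := d _ _ => h1 h2 h3 h4.
have n0 : 0 < n by lra.
have DD1 : D * D' <= 2 * c.
  rewrite -(ler_pM2r n0); apply: (@le_trans _ _ (c * m)); first by nra.
  by rewrite [2 * c]mulrC -mulrA ler_pM2l//; lra.
have DD2 : 1 <= 2 * c * (D * D').
  rewrite -(ler_pM2r n0) mul1r; nra.
have D'0 : 0 < D'.
  rewrite ltNge; apply/negP => D'0.
  have : D * D' <= 0 by rewrite pmulr_rle0.
  by nra.
by exists D' => //; split => //; exists (tau x), (tau y).
Qed.

(** On a ball that is small compared with its distance D to q, both factors of
the denominator are comparable to D. *)
Lemma inversion_scale D x q tau tau' u v : 0 < D -> inversion c q tau tau' ->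
  D <= c * d x q -> d x q <= c * D -> 2 * c * d x u <= D ->
      2 * c * d x v <= D ->
  d (tau u) (tau v) * D ^+ 2 <= 4 * c ^+ 3 * d u v /\
  d u v <= 4 * c ^+ 3 * (d (tau u) (tau v) * D ^+ 2).
Proof.
have c_ge1 := c1; have c_gt0 := c0.
move=> D0 [_ _ _ tE] Dx xD uD vD.
have near y : 2 * c * d x y <= D -> D <= 2 * c * d y q /\ d y q <= 2 * c * D.
  move=> yD; have := metric_triangle x y q; have := metric_triangle y x q.
  rewrite (metric_sym y x) => h1 h2; split; first by nra.
  have cD : D <= c * D by rewrite ler_peMl// ltW.
  have : d x y <= c * D; last by nra.
  apply: le_trans cD; have := mdist_ge0 x y; nra.
have [u1 u2] := near u uD; have [v1 v2] := near v vD.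
have uq : u != q by rewrite -mdist_gt0; nra.
have vq : v != q by rewrite -mdist_gt0; nra.
have [t1 t2] := tE u v uq vq.
set T := d (tau u) (tau v) in t1 t2 *; have T0 : 0 <= T by exact: mdist_ge0.
split.
  apply: (@le_trans _ _ (T * ((2 * c * d u q) * (2 * c * d v q)))).
    by rewrite ler_wpM2l// expr2 ler_pM// ltW.
  have -> : T * (2 * c * d u q * (2 * c * d v q)) = 4 * c ^+ 2 * (T * (d u q *
      d v q)) by ring.
  have -> : 4 * c ^+ 3 * d u v = 4 * c ^+ 2 * (c * d u v) by ring.
  by rewrite ler_pM2l// mulr_gt0// exprn_gt0.
apply: (le_trans t2).
have -> : 4 * c ^+ 3 * (T * D ^+ 2) = c * (T * ((2 * c * D) * (2 * c * D))) by
    ring.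
by rewrite ler_pM2l// ler_wpM2l// ler_pM// mdist_ge0.
Qed.

Lemma distance_scale D E : is_distance D -> is_distance E -> 2 * c * E <= D ->
  exists2 F, is_distance F &
    F * D ^+ 2 <= 4 * c ^+ 3 * E /\ E <= 4 * c ^+ 3 * (F * D ^+ 2).
Proof.
have c_ge1 := c1; have c_gt0 := c0.
move=> dD [E0 [x [y xyE]]] ED; have [q [Dx xD]] := distance_from x dD.
have [tau [tau' tI]] := inv q; have D0 := dD.1.
have := @inversion_scale D x q tau tau' x y D0 tI Dx xD.
rewrite mdistxx mulr0 xyE => /(_ (ltW D0) ED) [h1 h2].
exists (d (tau x) (tau y)) => //; split; last by exists (tau x), (tau y).
rewrite ltNge; apply/negP => T0.
have : d (tau x) (tau y) * D ^+ 2 <= 0 by rewrite pmulr_lle0// exprn_gt0.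
have : 0 < 4 * c ^+ 3 by rewrite mulr_gt0// exprn_gt0.
by move=> h3 h4; nra.
Qed.

Lemma small_distance (e : R) : 0 < e -> exists2 D, is_distance D & D < e.
Proof.
have c_ge1 := c1; have c_gt0 := c0.
move=> e0; have [x [y xy]] := unb (2 * c / e).
have xy0 : 0 < d x y by apply: lt_trans xy; rewrite divr_gt0// mulr_gt0.
have [|D' dD' [_ h]] := @distance_inv (d x y); first by split => //;
    exists x, y.
exists D' => //; have D'0 := dD'.1.
rewrite ltNge; apply/negP => eD'.
move: xy; rewrite ltr_pdivrMr// ltNge => /negP; apply.
by apply: le_trans h; rewrite ler_pM2l.
Qed.

(** Rescaling by D^-2 for one fixed small D multiplies a distance by a factor
between 2 and a constant; so starting below t and iterating, the distances of X
cannot jump over a long interval around t. *)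
Lemma distance_dense_small : exists2 D, is_distance D &
  exists2 K, 1 <= K & forall t, 0 < t -> 2 * c * t <= D ->
    exists2 s, is_distance s & t <= s /\ s <= K * t.
Proof.
have c_ge1 := c1; have c_gt0 := c0.
set a := 4 * c ^+ 3.
have a4 : 4 <= a.
  by have := exprn_ege1 3 c1; rewrite /a; lra.
have [|D dD Da] := @small_distance (2 * a)^-1; first by rewrite invr_gt0; lra.
have D0 := dD.1.
have aD : a * D ^+ 2 <= 2^-1.
  rewrite -[_^-1]mul1r ltr_pdivlMr in Da; last by lra.
  by rewrite expr2; nra.
exists D => //; exists (a / D ^+ 2).
  rewrite ler_pdivlMr ?exprn_gt0// mul1r; nra.
move=> t t0 tD.
have [x dx xt] := small_distance t0.
have x0 := dx.1.
have [n tn] := exists_pow_gt (t / x) (lexx 2).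
rewrite ltr_pdivrMr// in tn.
elim: n x dx xt x0 tn => [|n IH] x dx xt x0 tn.
  by move: tn; rewrite expr0 mul1r ltNge ltW.
have xD : 2 * c * x <= D.
  by apply: le_trans tD; rewrite ler_pM2l ?mulr_gt0// ltW.
have [y dy [yx xy]] := distance_scale dD dx xD; rewrite -/a in yx xy.
have y0 := dy.1.
have xy2 : 2 * x <= y by nra.
have [ty|yt] := leP t y.
  exists y => //; split => //; rewrite mulrAC ler_pdivlMr ?exprn_gt0//.
  apply: (le_trans yx); rewrite ler_pM2l; [exact: ltW|lra].
apply: (IH y) => //; apply: (lt_le_trans tn).
by rewrite exprS; have := exprn_gt0 n (ltr0n R 2); nra.
Qed.

(** Large t are handled by inverting small ones, and D itself serves for the t
in between. *)
Lemma distance_dense : exists2 K, 1 <= K & forall t, 0 < t ->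
  exists2 s, is_distance s & t <= K * s /\ s <= K * t.
Proof.
have c_ge1 := c1; have c_gt0 := c0.
have [D dD [K K1 KP]] := distance_dense_small; have D0 := dD.1.
exists (2 * c * K + 2 * c / D ^+ 2).
  have : 0 < 2 * c / D ^+ 2 by rewrite divr_gt0 ?exprn_gt0// mulr_gt0.
  nra.
set K' := _ + _.
have K'1 : 2 * c * K <= K'
    by rewrite /K' lerDl divr_ge0 ?exprn_ge0 ?mulr_ge0 ?(ltW c0) ?ltW.
have K'2 : 2 * c / D ^+ 2 <= K' by rewrite /K' lerDr ?mulr_ge0 ?(ltW c0)//; lra.
have K'3 : K <= K' by nra.
have K'4 : 2 * c <= K' by nra.
move=> t t0; have [tD|Dt] := leP (2 * c * t) D.
  have [s ds [ts st]] := KP t t0 tD; exists s => //; have s0 := ds.1.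
  split; [by nra|]; apply: (le_trans st); by rewrite ler_pM2r.
have [tD|Dt2] := leP (2 * c) (D * t).
  have [||s ds [ts st]] := KP t^-1; first by rewrite invr_gt0.
    by rewrite ler_pdivrMr.
  have [s' ds' [h1 h2]] := distance_inv ds; exists s' => //.
  have s0 := ds.1; have s'0 := ds'.1.
  have ts1 : 1 <= s * t by rewrite -ler_pdivrMr// mul1r.
  have st1 : s * t <= K by rewrite -ler_pdivlMr.
  split.
    apply: (@le_trans _ _ (2 * c * K * s')); last by rewrite ler_pM2r.
    have : t * 1 <= t * (2 * c * (s * s')) by rewrite ler_pM2l.
    have : 2 * c * s' * (s * t) <= 2 * c * s' * K
        by rewrite ler_pM2l// !mulr_gt0.
    by lra.
  apply: (@le_trans _ _ (2 * c * t)); last by rewrite ler_pM2r.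
  have : s' * 1 <= s' * (s * t) by rewrite ler_pM2l.
  have : s * s' * t <= 2 * c * t by rewrite ler_pM2r.
  by lra.
exists D => //; split.
  apply: (@le_trans _ _ (2 * c / D ^+ 2 * D)); last by rewrite ler_pM2r.
  by rewrite expr2 invfM mulrA divfK ?gt_eqF// ler_pdivlMr// mulrC ltW.
by apply: (le_trans (ltW Dt)); rewrite ler_pM2r.
Qed.

End distances.

(** A distance s comparable to t gives the factor s^-2; the ball has to be small
compared with s. *)
Lemma scale_down : exists2 K, 1 <= K & forall x (r t : R), 0 < t ->
    K * r <= t ->
  exists Phi : X -> X, forall u v, d x u <= r -> d x v <= r ->
    d (Phi u) (Phi v) * t ^+ 2 <= K * d u v /\
    d u v <= K * (d (Phi u) (Phi v) * t ^+ 2).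
Proof.
have c_ge1 := c1; have c_gt0 := c0.
have [K K1 dense] := distance_dense.
have c3 : c <= c ^+ 3 by apply: ler_eXnr.
have KK : K <= K ^+ 2 by apply: ler_eXnr.
pose a := 4 * c ^+ 3.
have a0 : 0 < a by rewrite /a; lra.
exists (a * K ^+ 2) => [|x r t t0 rt]; first by rewrite /a; nra.
have [s ds [ts st]] := dense t t0; have s0 := ds.1.
have [q [sx xs]] := distance_from x ds; have [tau [tau' tI]] := inv q.
have K0 : 0 < K by lra.
have near y : d x y <= r -> 2 * c * d x y <= s.
  move=> xyr; rewrite -(ler_pM2l K0); apply: le_trans ts; apply: le_trans rt.
  have : K * (2 * c) * d x y <= a * K ^+ 2 * d x y.
    apply: ler_wpM2r; first exact: mdist_ge0.
    by rewrite [leRHS]mulrC; apply: ler_pM; rewrite ?(ltW K0)//; rewrite /a;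
        lra.
  have : a * K ^+ 2 * d x y <= a * K ^+ 2 * r
      by rewrite ler_pM2l// mulr_gt0// exprn_gt0.
  by lra.
exists tau => u v /near xu /near xv.
have [] := inversion_scale s0 tI sx xs xu xv; rewrite -/a.
set T := d (tau u) (tau v); have T0 : 0 <= T by exact: mdist_ge0.
have ts2 : t ^+ 2 <= K ^+ 2 * s ^+ 2.
  by rewrite -exprMn lerXn2r// nnegrE ?mulr_ge0// ltW.
have st2 : s ^+ 2 <= K ^+ 2 * t ^+ 2.
  by rewrite -exprMn lerXn2r// nnegrE ?mulr_ge0// ltW.
move=> h1 h2; split.
  apply: (@le_trans _ _ (K ^+ 2 * (T * s ^+ 2))); last first.
    have -> : a * K ^+ 2 * d u v = K ^+ 2 * (a * d u v) by ring.
    by rewrite ler_pM2l// exprn_gt0.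
  by rewrite [leRHS]mulrCA ler_wpM2l.
apply: (le_trans h2); rewrite -[leRHS]mulrA ler_pM2l//.
by rewrite [leRHS]mulrCA ler_wpM2l.
Qed.

(** One inversion reaches only factors up to about r^-2.  A first rescaling, by
t1^-2 with t1 large, makes the ball so small that the second one, by t2^-2 with
t1 t2 = lam^(-1/2), is available. *)
Lemma scaling : exists2 K, 1 <= K & forall x y (r lam : R), 0 < r -> 0 < lam ->
  exists2 Phi : X -> X, Phi x = y & forall u v, d x u <= r -> d x v <= r ->
    d (Phi u) (Phi v) <= K * (lam * d u v) /\
    lam * d u v <= K * d (Phi u) (Phi v).
Proof.
have c_ge1 := c1; have c_gt0 := c0.
have [K K1 down] := scale_down; have K0 : 0 < K by lra.
exists (c * K ^+ 2) => [|x y r lam r0 lam0].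
  have : K <= K ^+ 2 by apply: ler_eXnr.
  by nra.
set m := Num.sqrt lam.
have m0 : 0 < m by rewrite sqrtr_gt0.
have lamE : lam = m ^+ 2 by rewrite sqr_sqrtr// ltW.
(* The first term makes the first rescaling possible, the second one makes the
   image small enough for the second rescaling. *)
pose t1 := K * r + K ^+ 2 * r * m.
have Kr : 0 < K * r by rewrite mulr_gt0.
have Krm : 0 < K ^+ 2 * r * m by rewrite !mulr_gt0// exprn_gt0.
have t10 : 0 < t1 by rewrite /t1; lra.
have [|Phi1 Phi1E] := down x r t1 t10; first by rewrite /t1; lra.
pose t2 := (t1 * m)^-1; pose r2 := K * r / t1 ^+ 2.
have t20 : 0 < t2 by rewrite invr_gt0 mulr_gt0.
have r2t2 : K * r2 <= t2.
  rewrite /t2 -[(_ * _)^-1]mul1r ler_pdivlMr ?mulr_gt0//.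
  have -> : K * r2 * (t1 * m) = K ^+ 2 * r * m / t1.
    by rewrite /r2; field; rewrite gt_eqF.
  by rewrite ler_pdivrMr// mul1r /t1; lra.
have [Phi2 Phi2E] := down (Phi1 x) r2 t2 t20 r2t2.
have [f [f' [[fK f'K fE] fy]]] := hom (Phi2 (Phi1 x)) y.
have xx : d x x <= r by rewrite mdistxx ltW.
have Phi1x u : d x u <= r -> d (Phi1 x) (Phi1 u) <= r2.
  move=> xu; rewrite /r2 ler_pdivlMr ?exprn_gt0//.
  have [h _] := Phi1E x u xx xu; apply: (le_trans h).
  by rewrite ler_pM2l.
exists (fun u => f (Phi2 (Phi1 u))) => // u v xu xv.
have [h1 h2] := Phi1E u v xu xv.
have [h3 h4] := Phi2E _ _ (Phi1x u xu) (Phi1x v xv).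
have [h5 h6] := fE (Phi2 (Phi1 u)) (Phi2 (Phi1 v)).
move: h1 h2 h3 h4 h5 h6.
set D1 := d (Phi1 u) (Phi1 v); set D2 := d (Phi2 _) _; set D3 := d (f _) _.
have -> : t2 ^+ 2 = (t1 ^+ 2 * lam)^-1 by rewrite lamE /t2 exprVn exprMn.
have tl0 : 0 < t1 ^+ 2 * lam by rewrite mulr_gt0// exprn_gt0.
have D10 : 0 <= D1 by exact: mdist_ge0.
have D20 : 0 <= D2 by exact: mdist_ge0.
move=> h1 h2; rewrite ler_pdivrMr// => h3;
    rewrite mulrA ler_pdivlMr// => h4 h5 h6.
split.
  apply: (le_trans h5); rewrite -mulrA ler_pM2l//; apply: (le_trans h3).
  have -> : K * D1 * (t1 ^+ 2 * lam) = K * lam * (D1 * t1 ^+ 2) by ring.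
  have -> : K ^+ 2 * (lam * d u v) = K * lam * (K * d u v) by ring.
  by rewrite ler_pM2l// mulr_gt0.
have e1 : lam * d u v <= lam * (K * (D1 * t1 ^+ 2)) by rewrite ler_pM2l.
apply: (le_trans e1).
have -> : lam * (K * (D1 * t1 ^+ 2)) = K * (D1 * (t1 ^+ 2 * lam)) by ring.
have -> : c * K ^+ 2 * D3 = K * (K * (c * D3)) by ring.
rewrite ler_pM2l//; apply: (le_trans h4).
by rewrite ler_pM2l.
Qed.

Lemma perfect_of_scaling : exists C, uniformly_perfect X C.
Proof.
have [K K1 scal] := scaling; have [x0 [y0 D0]] := unb 0.
exists (2 * K ^+ 2) => r x r0.
have lam0 : 0 < 2 * K * r / d x0 y0 by rewrite divr_gt0// !mulr_gt0//; lra.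
have [Phi Phix PhiE] := scal x0 x (d x0 y0) _ D0 lam0.
have [||] := PhiE x0 y0; [by rewrite mdistxx ltW|by []|].
rewrite divfK ?gt_eqF// Phix => h1 h2; exists (Phi y0).
by apply/andP; split; nra.
Qed.

(** By homogeneity some ball around each point lies in a compact set, with the
radius independent of the point. *)
Lemma complete_of_compact : (exists p (e : R) A, [/\ 0 < e, compact A &
  forall x, d p x < e -> A x]) -> cauchy_complete X.
Proof.
move=> [p [e [A [e0 Ac Ae]]]] u uC.
have [n0 n0P] := uC (e / c) (divr_gt0 e0 c0).
have [f [f' [[fK f'K fE] fp]]] := hom (u n0) p.
pose F := (f \o u) @ \oo.
have FA : F A.
  exists n0 => // n /= n0n; apply: Ae; rewrite -fp.
  have [h _] := fE (u n0) (u n); apply: (le_lt_trans h).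
  by rewrite mulrC -ltr_pdivlMr//; exact: n0P.
have [z [Az Fz]] := Ac F _ FA.
exists (f' z) => eps eps0.
have [n nP] := uC (eps / 4) (divr_gt0 eps0 (ltr0n R 4)).
exists n => m nm.
have Fn : F [set y | exists2 k, (n <= k)%N & y = f (u k)].
  by exists n => // k /= nk; exists k.
have ball_z : nbhs z [set y | d z y < eps / (4 * c)].
  apply/(@metricType_numDomainType.nbhs_mdistP _ X).
  by exists (eps / (4 * c)) => //=; rewrite divr_gt0// mulr_gt0.
have [y [[k nk ->] /= zy]] := Fz _ _ Fn ball_z.
have [_ h] := fE (f' z) (u k); rewrite f'K in h.
have h1 := nP m nm; have h2 := nP k nk.
have h3 : d (f' z) (u k) < eps / 4.
  apply: (le_lt_trans h); rewrite mulrC -ltr_pdivlMr//.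
  by apply: lt_le_trans zy _; rewrite invfM mulrA.
have := metric_triangle (u m) (u n) (f' z).
have := metric_triangle (u n) (u k) (f' z).
rewrite (metric_sym (u k)) (metric_sym (u m) (u n)); lra.
Qed.

Lemma compact_separated (A : set X) (eta : R) : compact A -> 0 < eta ->
  exists N : nat, forall (x : X) (s : seq X), (forall y, y \in s -> A y) ->
    (forall i j, (i < j < size s)%N -> eta <= d (nth x s i) (nth x s j)) ->
    (size s <= N)%N.
Proof.
move=> Ac eta0; have e2 : 0 < eta / 2 by rewrite divr_gt0.
have [D DA] : exists D : seq X, forall y, A y ->
    exists2 i, i \in D & d i y < eta / 2.
  pose F := filter_from [set: seq X] (fun D =>
      [set D' : seq X | {subset D <= D'}]).
  have FF : Filter F.
    apply: filter_from_filter; first by exists [::].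
    move=> D1 D2 _ _; exists (D1 ++ D2) => // D' /= DD'.
    by split=> i iD; apply: DD'; rewrite mem_cat iD ?orbT.
  have [|D0 _ /(_ D0)] := (compact_near_coveringP A).1 Ac _ F
    (fun D y => exists2 i, i \in D & d i y < eta / 2) FF.
    move=> x _; exists ([set y | d x y < eta / 2],
        [set D' : seq X | {subset [:: x] <= D'}]).
      split; last by exists [:: x].
      by apply/(@metricType_numDomainType.nbhs_mdistP _ X); exists (eta / 2).
    move=> [y D] /= [xy xD]; exists x => //; apply: xD; exact: mem_head.
  by move=> D0P; exists D0 => y; apply: D0P => i.
exists (size D) => x s sA sep.
have cen y : exists i, A y -> i \in D /\ d i y < eta / 2.
  have [/DA[i iD iy]|nA] := pselect (A y); first by exists i.
  by exists y.
have [g gP] := choice cen.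
have sepg i j : (i < j < size s)%N -> g (nth x s i) <> g (nth x s j).
  move=> ij gij; have [iS jS] : (i < size s)%N /\ (j < size s)%N.
    by case/andP: ij => ij js; split=> //; exact: ltn_trans js.
  have [_ h1] := gP _ (sA _ (mem_nth x iS));
      have [_ h2] := gP _ (sA _ (mem_nth x jS)).
  have := sep i j ij; have :=
      metric_triangle (nth x s i) (g (nth x s j)) (nth x s j).
  rewrite gij in h1; rewrite (metric_sym (nth x s i) (g _)).
  by move: h1 h2; lra.
have guniq : uniq (map g s).
  apply/(uniqP (g x)) => i j; rewrite !inE size_map => iS jS.
  rewrite !(nth_map x)// => gij; have [ltij|ltji|//] := ltngtP i j.
    by case: (sepg i j) => //; rewrite ltij.
  by case: (sepg j i) => //; rewrite ltji.
rewrite -(size_map g); apply: uniq_leq_size => // _ /mapP[y ys ->].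
by have [] := gP y (sA y ys).
Qed.

(** Rescale the ball to the size of a ball contained in a compact set. *)
Lemma doubling_of_compact : (exists p (e : R) A, [/\ 0 < e, compact A &
  forall x, d p x < e -> A x]) -> doubling X.
Proof.
move=> [p [e [A [e0 Ac Ae]]]] rho rho0.
have [K K1 scal] := scaling; have K0 : 0 < K by lra.
have eta0 : 0 < e * rho / (2 * K ^+ 2)
    by rewrite divr_gt0 ?mulr_gt0// exprn_gt0.
have [N NP] := compact_separated Ac eta0; exists N => r x s r0 sx sep.
have lam0 : 0 < e / (2 * K * r) by rewrite divr_gt0// !mulr_gt0.
have [Phi Phix PhiE] := scal x p r _ r0 lam0.
have xx : d x x <= r by rewrite mdistxx ltW.
rewrite -(size_map Phi); apply: (NP p).
  move=> _ /mapP[y ys ->]; apply: Ae; have xy := sx y ys.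
  rewrite -Phix; have [h _] := PhiE x y xx xy; apply: (le_lt_trans h).
  have -> : K * (e / (2 * K * r) * d x y) = e / 2 * (d x y / r).
    by field; rewrite !gt_eqF.
  apply: (@le_lt_trans _ _ (e / 2)); last by lra.
  by rewrite ger_pMr ?divr_gt0// ler_pdivrMr// mul1r.
move=> i j; rewrite size_map => ij;
    have [iS jS] : (i < size s)%N /\ (j < size s)%N.
    by case/andP: ij => ij js; split=> //; exact: ltn_trans js.
rewrite !(nth_map x)//.
have [_ h] := PhiE _ _ (sx _ (mem_nth x iS)) (sx _ (mem_nth x jS)).
rewrite -(ler_pM2l K0); apply: le_trans h.
have -> : K * (e * rho / (2 * K ^+ 2)) = e / (2 * K * r) * (rho * r).
  by field; rewrite !gt_eqF.
by rewrite ler_pM2l//; exact: sep.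
Qed.

Hypothesis cpl : cauchy_complete X.

(** Suppose tau(u_n) tends to q with u_n in A.  As A is bounded, the lower
estimate makes u_n a Cauchy sequence; let l be its limit.  If l is not q, then
tau(u_n) tends to tau(l), which is not q.  If l = q, then for a fixed y the
distance d(u_n, y) is at most a constant times d(u_n, q), hence tends to 0, and
y = q. *)
Lemma inversion_away q tau tau' A : inversion c q tau tau' -> mbounded A ->
  exists2 e : R, 0 < e & forall x, A x -> x != q -> e <= d (tau x) q.
Proof.
move=> [tK _ _ tE] /(mboundedP q)[B B0 AB]; apply: contrapT => nE.
have pick (n : nat) : exists x, [/\ A x, x != q & d (tau x) q < n.+1%:R^-1].
  apply: contrapT => nx; apply: nE; exists n.+1%:R^-1;
      first by rewrite invr_gt0.
  move=> x Ax xq; rewrite leNgt; apply/negP => xn; apply: nx.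
  by exists x.
have [u uP] := choice pick.
have small (e : R) : 0 < e -> exists n, forall m, (n <= m)%N ->
    d (tau (u m)) q < e.
  move=> e0; exists (Num.bound e^-1) => m nm; have [_ _ h] := uP m.
  apply: (lt_trans h); rewrite invf_plt ?posrE ?ltr0Sn//.
  have e0' : 0 <= e^-1 by rewrite invr_ge0 ltW.
  apply: (lt_trans (archi_boundP e0')).
  by rewrite ltr_nat ltnS.
have c_gt0 := c0.
have B2 : 0 < B ^+ 2 by rewrite exprn_gt0.
have [|l ul] := @cpl u.
  move=> e e0; have [|n nP] := small (e / (2 * (c * B ^+ 2))).
    by rewrite divr_gt0// !mulr_gt0.
  exists n => m nm; have [An nq _] := uP n; have [Am mq _] := uP m.
  have [_ h] := tE _ _ nq mq.
  have h1 := nP n (leqnn n); have h2 := nP m nm.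
  have h3 : d (tau (u n)) (tau (u m)) < e / (c * B ^+ 2).
    have -> : e / (c * B ^+ 2) = 2 * (e / (2 * (c * B ^+ 2))).
      by field; rewrite !gt_eqF.
    have := metric_triangle (tau (u n)) q (tau (u m)).
    by rewrite (metric_sym q); lra.
  apply: (le_lt_trans h);
      apply: (@le_lt_trans _ _ (d (tau (u n)) (tau (u m)) * (c * B ^+ 2))).
    rewrite mulrCA ler_wpM2l ?mdist_ge0// ler_pM2l// expr2.
    by apply: ler_pM; rewrite ?mdist_ge0// metric_sym; exact: AB.
  by rewrite -ltr_pdivlMr// mulr_gt0.
have [lq|lq] := eqVneq l q.
  have [y qy] := far_point q 0; have yq : y != q by rewrite eq_sym -mdist_gt0.
  set E := 1 + d q (tau y).
  have E0 : 0 < E by rewrite ltr_wpDr// mdist_ge0.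
  have yq0 : 0 < d y q by rewrite mdist_gt0.
  (* u_n closer than e to q makes d(y, u_n) + d(u_n, q) smaller than d(y, q). *)
  pose e := d y q / (2 * (1 + c * E * d y q)).
  have cE0 : 0 < c * E * d y q by rewrite !mulr_gt0.
  have e0 : 0 < e by rewrite divr_gt0// mulr_gt0//; lra.
  have [n1 n1P] := small 1 ltr01; have [n2 n2P] := ul e e0.
  pose n := maxn n1 n2.
  have h1 := n1P n (leq_maxl _ _); have h2 := n2P n (leq_maxr _ _).
  have [_ nq _] := uP n; have [_ h3] := tE _ _ nq yq; rewrite lq in h2.
  have h4 : d (tau (u n)) (tau y) <= E.
    by rewrite /E; have := metric_triangle (tau (u n)) q (tau y); lra.
  have h5 : d (u n) y <= c * E * d y q * e.
    have -> : c * E * d y q * e = c * (E * (e * d y q)) by ring.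
    apply: (le_trans h3); rewrite ler_pM2l//.
    apply: ler_pM; rewrite ?mulr_ge0 ?mdist_ge0//.
    by rewrite ler_pM2r// ltW.
  have h6 : (1 + c * E * d y q) * e < d y q.
    rewrite /e mulrA ltr_pdivrMr; last by rewrite mulr_gt0//; lra.
    by nra.
  have := metric_triangle y (u n) q; rewrite (metric_sym y (u n)).
  by lra.
have [tlq t'l] := tK l lq.
have lq0 : 0 < d l q by rewrite mdist_gt0.
have tlq0 : 0 < d (tau l) q by rewrite mdist_gt0.
pose D := d (tau l) q.
have D2 : 0 < D / 2 by rewrite divr_gt0.
have e0 : 0 < D * d l q ^+ 2 / (4 * c)
    by rewrite divr_gt0 ?mulr_gt0// exprn_gt0.
have lq2 : 0 < d l q / 2 by rewrite divr_gt0.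
have [n1 n1P] := small _ D2; have [n2 n2P] := ul _ e0;
    have [n3 n3P] := ul _ lq2.
pose n := maxn n1 (maxn n2 n3).
have h1 := n1P n (leq_maxl _ _).
have h2 : d (u n) l < D * d l q ^+ 2 / (4 * c) by apply: n2P;
    rewrite !leq_max leqnn orbT.
have h3 : d (u n) l < d l q / 2 by apply: n3P; rewrite !leq_max leqnn !orbT.
have [_ nq _] := uP n; have [h4 _] := tE _ _ nq lq.
have h5 : d l q / 2 <= d (u n) q.
  by have := metric_triangle l (u n) q; rewrite (metric_sym l (u n)); lra.
have h6 : D / 2 < d (tau (u n)) (tau l).
  have := metric_triangle (tau l) (tau (u n)) q;
      rewrite (metric_sym (tau l) (tau (u n))) -/D.
  by lra.
have h7 : D / 2 * (d l q / 2 * d l q) < c * (D * d l q ^+ 2 / (4 * c)).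
  apply: (@lt_le_trans _ _ (d (tau (u n)) (tau l) * (d l q / 2 * d l q))).
    by rewrite ltr_pM2r// mulr_gt0.
  apply: (@le_trans _ _ (d (tau (u n)) (tau l) * (d (u n) q * d l q))).
    by rewrite ler_wpM2l ?mdist_ge0// ler_pM2r.
  by apply: (le_trans h4); rewrite ler_pM2l// ltW.
have : c * (D * d l q ^+ 2 / (4 * c)) = D / 2 * (d l q / 2 * d l q).
  by field; rewrite gt_eqF.
by move=> e; rewrite e ltxx in h7.
Qed.

(** The image is closed away from q since tau is a bijection there, and it does
not accumulate at q by [inversion_away]. *)
Lemma inversion_clopen q tau tau' A : inversion c q tau tau' ->
    open (~` A) -> ~ A q ->
  mbounded A -> open (~` (tau @` A)).
Proof.
move=> tI Ao nAq Ab.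
have [e e0 eP] := inversion_away tI Ab.
have Cq := inversion_complement tI nAq.
have [_ _ tO _] := tI.
have : open (tau @` (~` A `\ q)) by apply: tO;
    [exact: open_setD1|exact: setD1_notin].
move=> /openP oT.
apply/openP => y nAy.
have [yq|/eqP yq] := eqVneq y q.
  exists e => // z yz [x Ax xz]; move: yz; rewrite yq -xz metric_sym ltNge.
  by rewrite eP//; apply/eqP => xq; rewrite xq in Ax.
have [|r r0 rP] := oT y; first by rewrite -Cq.
by exists r => // z /rP; rewrite -Cq => -[].
Qed.

(** P meets the closure of its complement at x at most, so it hangs on the rest
of the space at that point. *)
Definition petal x P := [/\ open (~` P), P x, open (P `\ x) & mbounded P].

Section no_bounded_clopen.
Hypothesis noclopen : forall A x, open A -> open (~` A) -> mbounded A -> ~ A x.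

(** Where one of the petals fails to be open, the other one or its complement
takes over: if x is in Q then the union of P and Q is clopen, and if not then
the difference of Q and P is. *)
Lemma petal_nested x y P Q : petal x P -> petal y Q -> P y -> y != x ->
    Q `<=` P.
Proof.
move=> [Pc Px Po Pb] [Qc Qy Qo Qb] Py /eqP yx.
have [Qx|nQx] := pselect (Q x).
  suff : ~ (P `|` Q) x by case; left.
  apply: noclopen.
  - rewrite (_ : P `|` Q = (P `\ x) `|` (Q `\ y)); first exact: openU.
    apply/seteqP; split => z /=; last by move=> [[? _]|[? _]]; [left|right].
    have [->|/eqP zx] := eqVneq z x; first by right; split => //; exact: nesym.
    have [->|/eqP zy] := eqVneq z y; first by left.
    by move=> [Pz|Qz]; [left|right].
  - by rewrite setCU; exact: openI.
  - exact: mboundedU.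
move=> z Qz; apply: contrapT => nPz.
suff : ~ (Q `\` P) z by apply; split.
apply: noclopen.
- rewrite (_ : Q `\` P = (Q `\ y) `&` ~` P); first exact: openI.
  by apply/seteqP; split => w /= [Qw nPw]; [split=> //; split=> // wy;
      rewrite wy in nPw|case: Qw].
- rewrite (_ : ~` (Q `\` P) = ~` Q `|` (P `\ x)); first exact: openU.
  apply/seteqP; split => w /=.
    move=> nw; have [Qw|] := pselect (Q w); last by left.
    right; have Pw : P w by apply: contrapT => nPw; apply: nw.
    by split=> // wx; rewrite wx in Qw.
  by move=> [nQw|[Pw _]] [Qw nPw].
- by apply: mboundedS Qb => w [].
Qed.

Lemma petal_image f f' x P : bilipschitz c f f' -> petal x P ->
    petal (f x) (f @` P).
Proof.
move=> fI [Pc Px Po Pb]; have [fK f'K fE] := fI; have c_gt0 := c0.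
have finj : injective f by exact: can_inj fK.
split.
- rewrite (_ : ~` (f @` P) = f @` (~` P)); first exact: bilipschitz_open fI _.
  apply/seteqP; split=> y /=.
    by move=> nPy; exists (f' y) => // Py; apply: nPy; exists (f' y).
  by move=> [z nPz <-] [w Pw /finj wz]; rewrite wz in Pw.
- by exists x.
- rewrite (_ : f @` P `\ f x = f @` (P `\ x));
    first exact: bilipschitz_open fI _.
  apply/seteqP; split=> y /=.
    by move=> [[z Pz <-] zx]; exists z => //; split => // zx'; apply: zx;
        rewrite zx'.
  by move=> [z [Pz zx] <-]; split; [exists z|move=> /finj].
- have [B B0 PB] := mboundedP x Pb; exists (f x), (c * B) => _ [z Pz <-].
  by apply: le_trans (fE x z).1 _; rewrite ler_pM2l//; exact: PB.
Qed.

(** Inversion at p turns the part V of the separation that misses p into a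
bounded set that can fail to be closed at p only.  It must accumulate at p,
otherwise it would be clopen. *)
Lemma petal_exists U p v : open U -> open (~` U) -> U p -> ~ U v ->
  exists P, petal p P /\ forall e : R, 0 < e ->
      exists q, [/\ P q, q != p & d p q < e].
Proof.
move=> Uo Vo Up nUv; have [tau [tau' tI]] := inv p; have [tK t'K tO _] := tI.
have vp : v != p by apply/eqP => e; rewrite e in nUv.
have [e e0 eP] : exists2 e : R, 0 < e & forall x, (~` U) x -> e <= d x p.
  move/openP: (Uo) => /(_ p Up)[e e0 eU]; exists e => // x nUx.
  by rewrite leNgt; apply/negP; rewrite metric_sym => /eU.
have Vb : mbounded (tau @` ~` U) by exact: inversion_bounded tI e0 eP.
have Vopen : open (tau @` ~` U) by exact: tO.
have nVp : ~ (tau @` ~` U) p.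
  move=> [x nUx txp]; have xp : x != p by apply/eqP => xp; rewrite xp in nUx.
  by have [/eqP] := tK x xp; rewrite txp.
pose P := tau @` (~` U) `|` [set p].
have Pp : P `\ p = tau @` ~` U.
  apply/seteqP; split=> y /=; first by move=> [[]].
  by move=> Vy; split; [left|move=> yp; rewrite yp in Vy].
exists P; split; first split.
- rewrite /P setCU1 (inversion_complement tI); last by apply.
  by rewrite setCK; apply: tO; [exact: open_setD1|exact: setD1_notin].
- by right.
- by rewrite Pp.
- by apply: mboundedU Vb (mbounded1 p).
move=> r r0; apply: contrapT => nq.
suff : ~ (tau @` ~` U) (tau v) by apply; exists v.
apply: noclopen => //; apply/openP => y nVy.
have [->|/eqP yp] := eqVneq y p.
  exists r => // z pz Vz; apply: nq; exists z; split=> //; first by left.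
  by apply/eqP => zp; rewrite zp in Vz.
have : open (tau @` (~` ~` U `\ p)) by rewrite setCK; apply: tO;
    [exact: open_setD1|exact: setD1_notin].
rewrite -(inversion_complement tI); last by apply.
move=> /openP/(_ y)[|s s0 sP]; first by split.
by exists s => // z /sP[].
Qed.

(** The complement of P reaches infinity, and the inversion at q in P turns it
into a bounded set to which q has to be added; together with tau(p) this is a
petal at tau(p).  The inversion stretches distances from p by about
1 / d(p, q), so the petal is large when q is close to p. *)
Lemma petal_blowup p P (B : R) : petal p P ->
  (forall e : R, 0 < e -> exists q, [/\ P q, q != p & d p q < e]) ->
  exists q z w Q, [/\ P q /\ q != p, petal z Q, Q w & B < d z w].
Proof.
move=> [Pc Pp Po Pb] acc; have c_gt0 := c0.
have [b b0 Pb'] := mboundedP p Pb; have [w bw] := far_point p b.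
have nPw : ~ P w by move=> /Pb'; rewrite leNgt bw.
have B1 : 0 < `|B| + 1 by rewrite ltr_wpDl.
have pw0 : 0 < d p w by apply: lt_trans bw.
(* For d(p, q) < e, the estimate of d(p, w) by the distance of the images of p
   and w rules out that the latter is at most B; 1 is a bound for d(p, q) that
   keeps d(w, q) under control. *)
pose e := d p w / (c * (`|B| + 1) * (d p w + 1)).
have e0 : 0 < e by rewrite divr_gt0// !mulr_gt0//; lra.
have [q [Pq qp qe]] : exists q, [/\ P q, q != p & d p q < Num.min e 1].
  by apply: acc; rewrite lt_min e0 ltr01.
move: qe; rewrite lt_min => /andP[qe q1].
have [tau [tau' tI]] := inv q; have [tK t'K tO tE] := tI.
have pq : p != q by rewrite eq_sym.
have wq : w != q by apply/eqP => wq; rewrite wq in nPw.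
pose W := ~` (P `\ p).
have nWq : ~ W q by apply; split=> //; exact/eqP.
have [r r0 rP] : exists2 r : R, 0 < r & forall x, W x -> r <= d x q.
  move/openP: Po => /(_ q)[|r r0 rP]; first by split=> //; exact/eqP.
  by exists r => // x Wx; rewrite leNgt; apply/negP; rewrite metric_sym => /rP.
have [tpq t'p] := tK p pq.
exists q, (tau p), (tau w), (tau @` W `|` [set q]); split=> //; first split.
- rewrite setCU1 (inversion_complement tI)// /W setCK.
  by apply: tO; [exact: open_setD1|exact: setD1_notin].
- by left; exists p => // -[_]; apply.
- have [s s0 sP] := inversion_away tI Pb.
  have oT : open (tau @` ~` P) by apply: tO.
  apply/openP => y; have [-> _|/eqP yq [[|//]]] := eqVneq y q.
    have tpq0 : 0 < d q (tau p) by rewrite mdist_gt0 eq_sym.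
    exists (Num.min s (d q (tau p))) => [|z]; first by rewrite lt_min s0.
    rewrite lt_min => /andP[zs zp]; split; last by move=> zE;
        rewrite zE ltxx in zp.
    have [->|zq] := eqVneq z q; first by right.
    left; have [t'zq tz] := t'K z zq; exists (tau' z) => // -[Pt'z _].
    by have := sP _ Pt'z t'zq; rewrite tz metric_sym leNgt zs.
  move=> [x Wx xy] yp; have nPx : ~ P x.
    by move=> Px; apply: Wx; split=> // xp; apply: yp; rewrite -xy xp.
  move/openP: oT => /(_ y)[|r' r'0 r'P]; first by exists x.
  exists r' => // z /r'P[x' nPx' <-]; have x'q : x' != q by apply/eqP => E;
      rewrite E in nPx'.
  split; first by left; exists x' => // -[].
  move=> tx'p; have [_ t'x'] := tK x' x'q.
  by apply: nPx'; rewrite -t'x' tx'p t'p.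
- exact: mboundedU (inversion_bounded tI r0 rP) (mbounded1 q).
- by left; exists w => // -[].
have [_] := tE p w pq wq; rewrite leNgt; apply: contraNlt => DB.
have wq1 : d w q <= d p w + 1.
  by have := metric_triangle w p q; rewrite (metric_sym w p); lra.
have DB' : d (tau p) (tau w) <= `|B| + 1.
  by apply: (le_trans DB); have := ler_norm B; lra.
apply: (@le_lt_trans _ _ (c * (`|B| + 1) * (d p w + 1) * d p q)).
  have -> : c * (`|B| + 1) * (d p w + 1) * d p q = c * ((`|B| + 1) * (d p q *
      (d p w + 1))) by ring.
  rewrite ler_pM2l//; apply: ler_pM; rewrite ?mulr_ge0 ?mdist_ge0//.
  by rewrite ler_wpM2l ?mdist_ge0.
by rewrite mulrC -ltr_pdivlMr// !mulr_gt0// addr_gt0.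
Qed.

(** A petal too large to fit into P, carried to a point q of P by homogeneity,
contradicts [petal_nested]. *)
Lemma connected_of_noclopen U p v : open U -> open (~` U) -> U p -> U v.
Proof.
move=> Uo Vo Up; apply: contrapT => nUv.
have [P [Pp acc]] := petal_exists Uo Vo Up nUv; have c_gt0 := c0.
have [_ _ _ /(mboundedP p)[b b0 Pb]] := Pp.
have [q [z [w [Q [[Pq qp] zQ Qw zw]]]]] := petal_blowup (c * (2 * b)) Pp acc.
have [f [f' [fI fz]]] := hom z q; have [_ _ fE] := fI.
have := petal_image fI zQ; rewrite fz => qfQ.
have sub := petal_nested Pp qfQ Pq qp.
have Pfw : P (f w) by apply: sub; exists w.
have [_ h] := fE z w; rewrite fz in h.
have := metric_triangle q p (f w); rewrite (metric_sym q p).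
have := Pb _ Pq; have := Pb _ Pfw => h1 h2 h3.
have : d z w <= c * (2 * b) by apply: (le_trans h); rewrite ler_pM2l//; lra.
by rewrite leNgt zw.
Qed.

End no_bounded_clopen.

Lemma bounded_clopen_exists : ~ connected [set: X] ->
  exists A x, [/\ open A, open (~` A), mbounded A & A x].
Proof.
move=> disc; apply: contrapT => nA.
have noclopen A x : open A -> open (~` A) -> mbounded A -> ~ A x.
  by move=> Ao Ac Ab Ax; apply: nA; exists A, x.
apply: disc => B [b Bb] [C Co BC] [D Dc BD].
rewrite setTI in BC; rewrite setTI in BD.
apply/seteqP; split=> // x _; apply: (connected_of_noclopen noclopen) Bb.
  by rewrite BC.
by rewrite BD; exact: closed_openC.
Qed.

Lemma compact_open_gap A : compact A -> open A ->
  exists2 g : R, 0 < g & forall u v, A u -> d u v < g -> A v.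
Proof.
move=> Ac /openP Ao.
have [|e e0 eP] := (compact_near_coveringP A).1 Ac R^o (0^'+)
    (fun g u => forall v, d u v < g -> A v) _.
  move=> u Au; have [e e0 eA] := Ao u Au.
  have e2 : 0 < e / 2 by rewrite divr_gt0.
  exists ([set x | d u x < e / 2], [set g : R | g < e / 2]).
    split.
      by apply/(@metricType_numDomainType.nbhs_mdistP _ X); exists (e / 2).
    exact: nbhs_right_lt.
  move=> [x g] /= [ux ge] v xv; apply: eA.
  by have := metric_triangle u x v; lra.
exists (e / 2); first by rewrite divr_gt0.
move=> u v Au uv; apply: (eP (e / 2)) Au v uv => /=; last by rewrite divr_gt0.
rewrite sub0r normrN gtr0_norm ?divr_gt0//.
by move: (e : R) e0 => x /= x0; lra.
Qed.

(** Inversion at a far point q shrinks a bounded clopen set as much as desired;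
moving its image into a compact ball makes it compact. *)
Lemma small_compact_open : ~ connected [set: X] ->
  (exists p (e : R) A, [/\ 0 < e, compact A & forall x, d p x < e -> A x]) ->
  exists A x, [/\ compact A, open A & A x].
Proof.
move=> disc [p [e [C [e0 Cc Ce]]]]; have c_gt0 := c0.
have [A [a [Ao nAo Ab Aa]]] := bounded_clopen_exists disc.
have [b b0 Ab'] := mboundedP a Ab.
(* For points further than m from q the inversion divides distances by more than
   m^2 / c, hence by m / c; another factor c comes from moving to p. *)
pose m := Num.max 1 (2 * b * c ^+ 2 / e).
have [q bq] := far_point a (b + m).
have m1 : 1 <= m by rewrite le_max lexx.
have far x : A x -> m < d x q.
  by move=> /Ab' ax; have := metric_triangle a x q; lra.
have nAq : ~ A q by move=> /far; rewrite mdistxx; lra.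
have [tau [tau' tI]] := inv q; have [_ _ tO tE] := tI.
have [f [f' [fI fp]]] := hom (tau a) p; have [fK f'K fE] := fI.
pose A' := f @` (tau @` A).
have tAo : open (tau @` A) by exact: tO.
have A'o : open A' by exact: bilipschitz_open fI _.
have A'c : closed A'.
  rewrite -[A']setCK; apply: open_closedC.
  rewrite (_ : ~` A' = f @` (~` (tau @` A))).
    by apply: bilipschitz_open fI _ => //; exact: inversion_clopen tI _ _ _.
  apply/seteqP; split=> y /=.
    by move=> nAy; exists (f' y) => // ?; apply: nAy; exists (f' y).
  by move=> [z nz <-] [w Aw /(can_inj fK) wz]; rewrite wz in Aw.
exists A', p; split=> //; last by rewrite -fp; exists (tau a) => //; exists a.
apply: subclosed_compact A'c Cc _ => _ [_ [x Ax <-] <-]; apply: Ce.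
rewrite -fp; apply: le_lt_trans (fE _ _).1 _.
have neq y : A y -> y != q by move=> /far my; rewrite -mdist_gt0; lra.
have [h _] := tE a x (neq a Aa) (neq x Ax); set D := d (tau a) _ in h *.
have ma := far a Aa; have mx := far x Ax; have ax := Ab' x Ax.
have D0 : 0 <= D by exact: mdist_ge0.
have m0 : 0 < m by lra.
have h1 : D * m <= c * b.
  apply: le_trans (_ : D * (d a q * d x q) <= _); last first.
    by apply: (le_trans h); rewrite ler_pM2l.
  rewrite ler_wpM2l// -[leLHS]mulr1.
  by apply: ler_pM; rewrite ?ltW//; lra.
have h2 : 2 * b * c ^+ 2 <= e * m.
  by rewrite [leRHS]mulrC -ler_pdivrMr// le_max lexx orbT.
rewrite -(ltr_pM2r m0); apply: (@le_lt_trans _ _ (c * (c * b))).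
  by rewrite -mulrA ler_pM2l.
have : 0 < b * c ^+ 2 by rewrite mulr_gt0// exprn_gt0.
by rewrite expr2 in h2 *; lra.
Qed.

(** Rescale so that r becomes a bit more than the diameter of A and x goes to a
point of A: steps shorter than delta r become shorter than the gap between A and
its complement, so that the image of the chain never leaves A. *)
Lemma disconnected_of_compact_open A a : compact A -> open A -> A a ->
  exists2 delta, 0 < delta & uniformly_disconnected X delta.
Proof.
move=> Ac Ao Aa; have [g g0 gP] := compact_open_gap Ac Ao.
have [K K1 scal] := scaling; have K0 : 0 < K by lra.
have [b b0 Ab] : exists2 b : R, 0 < b & forall x, A x -> d a x <= b.
  pose cov (b : R) x := d a x <= b.
  have [|b [b0 bP]] := (compact_near_coveringP A).1 Ac R (+oo) cov _.
    move=> x Ax; exists ([set y | d x y < 1], [set b : R | d a x + 1 < b]).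
      split; first by apply/(@metricType_numDomainType.nbhs_mdistP _ X);
          exists 1 => //=; exact: ltr01.
      by apply: nbhs_pinfty_gt; rewrite num_real.
    move=> [y b] /= [xy xb]; rewrite /cov /=.
    by have := metric_triangle a x y; lra.
  exists (`|b| + 1) => [|x Ax]; first by rewrite ltr_wpDl.
  by apply: (bP (`|b| + 1)) => //; have := ler_norm b; lra.
have Kb : 0 < K ^+ 2 * (b + 1) by rewrite mulr_gt0 ?exprn_gt0//; lra.
(* At most 1, so that a step cannot leave the ball of radius 2 r. *)
pose delta := g / (g + K ^+ 2 * (b + 1)).
have gKb : 0 < g + K ^+ 2 * (b + 1) by lra.
have delta1 : delta <= 1 by rewrite ler_pdivrMr// mul1r; lra.
have deltag : K ^+ 2 * (b + 1) * delta <= g.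
  rewrite /delta mulrA ler_pdivrMr// mulrC ler_pM2l//; lra.
have delta0 : 0 < delta by rewrite divr_gt0.
exists delta => // r x y r0 xy.
have r20 : 0 < 2 * r by rewrite mulr_gt0.
have lam0 : 0 < K * (b + 1) / r by rewrite divr_gt0// mulr_gt0//; lra.
have [Phi Phix PhiE] := scal x a _ _ r20 lam0.
suff [] : d x y <= r /\ A (Phi y) by [].
have xx : d x x <= 2 * r by rewrite mdistxx ltW.
refine (xy [set z | d x z <= r /\ A (Phi z)] _ _) => /=.
  by rewrite mdistxx Phix; split=> //; exact: ltW.
move=> u v [xu Au] uv.
have xu2 : d x u <= 2 * r by lra.
have uvr : d u v < r.
  by apply: (lt_le_trans uv); rewrite ger_pMl.
have xv2 : d x v <= 2 * r by have := metric_triangle x u v; lra.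
have Av : A (Phi v).
  apply: gP Au _; apply: le_lt_trans (PhiE u v xu2 xv2).1 _.
  apply: lt_le_trans deltag.
  have -> : K * (K * (b + 1) / r * d u v) = K ^+ 2 * (b + 1) * (d u v / r).
    by field; rewrite gt_eqF.
  by rewrite ltr_pM2l// ltr_pdivrMr.
split=> //; have [_] := PhiE x v xx xv2; rewrite Phix => h.
have h' : K * (b + 1) / r * d x v <= K * b.
  by apply: (le_trans h); rewrite ler_pM2l//; exact: Ab.
have lamE : K * (b + 1) / r * d x v = K * ((b + 1) * d x v / r).
  by field; rewrite gt_eqF.
rewrite lamE ler_pM2l// ler_pdivrMr// in h'.
have b10 : 0 < b + 1 by lra.
by rewrite -(ler_pM2l b10); apply: (le_trans h'); rewrite ler_pM2r//; lra.
Qed.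

End invertible_homogeneous.

(** * From the hypotheses on the space to inversions at every point *)

Section hypotheses.
Context {R : realType} (X : metricType R).
Local Notation d := (@mdist R X).
Implicit Types (x y u v p q : X) (c L : R).

Lemma comparableP L (a b : R) : 1 <= L -> comparable_up_to L a b ->
  a <= L * b /\ b <= L * a.
Proof.
move=> L1 /andP[h1 h2]; split=> //.
by rewrite -ler_pdivrMl// (lt_le_trans ltr01).
Qed.

Lemma bilipschitz_le c c' (f f' : X -> X) : c <= c' -> bilipschitz c f f' ->
    bilipschitz c' f f'.
Proof.
move=> cc' [fK f'K fE]; split=> // u v; have [h1 h2] := fE u v.
by split; [apply: le_trans h1 _|apply: le_trans h2 _];
    rewrite ler_wpM2r ?mdist_ge0.
Qed.

Lemma inversion_le c c' q (tau tau' : X -> X) : c <= c' ->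
    inversion c q tau tau' ->
  inversion c' q tau tau'.
Proof.
move=> cc' [tK t'K tO tE]; split=> // u v uq vq; have [h1 h2] := tE u v uq vq.
by split; [apply: le_trans h1 _|apply: le_trans h2 _];
    rewrite ler_wpM2r ?mulr_ge0 ?mdist_ge0.
Qed.

Lemma homogeneous_bilipschitz : uniformly_bilipschitz_homogeneous X ->
  exists2 L : R, 1 <= L & forall x y, exists f f',
      bilipschitz L f f' /\ f x = y.
Proof.
move=> [L L1 LP]; exists L => // x y.
have [f [[_ _ [g [_ _ fg gf]]] fxy fE]] := LP x y.
exists f, g; split=> //; split=> [u|u|u v].
- by apply: fg; rewrite in_setT.
- by apply: gf; rewrite in_setT.
- exact: comparableP.
Qed.

Lemma quasi_invertible_inversion : quasi_invertible X ->
  exists p L sigma sigma', 1 <= L /\ @inversion R X L p sigma sigma'.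
Proof.
move=> [p [L [s [L1 [sc sp [g [gc gp sg gs]]] sE]]]]; exists p, L, s, g;
    split=> //.
have neq x : x != p -> (~` [set p]) x by move/eqP.
split.
- move=> x /neq xp; split; first by apply/eqP; exact: sp.
  by apply: sg; rewrite inE.
- move=> x /neq xp; split; first by apply/eqP; exact: gp.
  by apply: gs; rewrite inE.
- move=> U Uo nUp.
  have po : open (~` [set p]).
    by have := open_setD1 p (@openT X); rewrite setTD.
  have := (continuous_inP g po).1 _ U Uo.
  rewrite (_ : ~` [set p] `&` g @^-1` U = s @` U).
    by apply; rewrite -continuous_open_subspace.
  apply/seteqP; split=> x /=.
    by move=> [xp Ugx]; exists (g x) => //; apply: gs; rewrite inE.
  move=> [y Uy <-]; have yp : (~` [set p]) y by move=> yp; rewrite yp in Uy.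
  by split; [exact: sp|rewrite sg// inE].
move=> u v up vp; have [h1 h2] := comparableP L1 (sE u v up vp).
have uvp : 0 < d u p * d v p by rewrite mulr_gt0// mdist_gt0.
split; first by rewrite -ler_pdivlMr// -mulrA.
have -> : L * (d (s u) (s v) * (d u p * d v p)) = L * d (s u) (s v) * (d u p *
    d v p).
  by ring.
by rewrite -ler_pdivrMr.
Qed.

(** The five factors c are the constant of the inversion at p and the
distortions of the four distances that occur in its estimates. *)
Lemma inversion_conj c p q (f f' s s' : X -> X) : 1 <= c ->
    bilipschitz c f f' -> f p = q ->
  inversion c p s s' -> inversion (c ^+ 5) q (f \o s \o f') (f \o s' \o f').
Proof.
move=> c1 [fK f'K fE] fp [sK s'K sO sE];
    have c0 : 0 < c by apply: lt_le_trans c1.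
have f'q : f' q = p by rewrite -fp fK.
have f'p x : x != q -> f' x != p.
  by apply: contraNneq => e; rewrite -fp -e f'K.
have fneq x : x != p -> f x != q.
  by apply: contraNneq => e; rewrite -f'q -e fK.
have f'I : bilipschitz c f' f.
  split=> // u v; have [] := fE (f' u) (f' v); rewrite !f'K => h1 h2.
  by split.
split.
- move=> x /f'p xp; have [sxp ss] := sK _ xp.
  by split; [exact: fneq|rewrite /= fK ss f'K].
- move=> x /f'p xp; have [sxp ss] := s'K _ xp.
  by split; [exact: fneq|rewrite /= fK ss f'K].
- move=> U Uo nUq.
  have -> : (f \o s \o f') @` U = f @` (s @` (f' @` U)) by rewrite !image_comp.
  apply: (bilipschitz_open c0); first by split;
      [exact: fK|exact: f'K|exact: fE].
  apply: sO; first exact: (bilipschitz_open c0 f'I Uo).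
  by move=> [x Ux f'xp]; apply: nUq; rewrite -fp -f'xp f'K.
move=> u v uq vq /=; have [h1 h2] := sE _ _ (f'p u uq) (f'p v vq).
have [_ _ f'E] := f'I.
have [t1 t2] := fE (s (f' u)) (s (f' v)).
have [a1 a2] := f'E u v.
have [u1 u2] := f'E u q; have [v1 v2] := f'E v q; rewrite f'q in u1 u2 v1 v2.
set T := d (f _) (f _) in t1 t2 *; set S := d (s _) (s _) in h1 h2 t1 t2.
set u' := d (f' u) p in h1 h2 u1 u2; set v' := d (f' v) p in h1 h2 v1 v2.
set w := d (f' u) (f' v) in h1 h2 a1 a2.
have T0 : 0 <= T by exact: mdist_ge0.
have S0 : 0 <= S by exact: mdist_ge0.
have u0 : 0 <= u' by exact: mdist_ge0.
have v0 : 0 <= v' by exact: mdist_ge0.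
have uq0 : 0 <= d u q by exact: mdist_ge0.
have vq0 : 0 <= d v q by exact: mdist_ge0.
split.
  apply: (@le_trans _ _ ((c * S) * ((c * u') * (c * v')))).
    by apply: ler_pM => //; [exact: mulr_ge0|exact: ler_pM].
  have -> : c * S * (c * u' * (c * v')) = c ^+ 3 * (S * (u' * v')) by ring.
  have -> : c ^+ 5 * d u v = c ^+ 3 * (c * (c * d u v)) by ring.
  rewrite ler_pM2l ?exprn_gt0//; apply: (le_trans h1).
  by rewrite ler_pM2l.
have -> : c ^+ 5 * (T * (d u q * d v q)) = c * (c * ((c * T) * ((c * d u q) *
    (c * d v q)))) by ring.
apply: (le_trans a2); rewrite ler_pM2l//; apply: (le_trans h2);
    rewrite ler_pM2l//.
by apply: ler_pM => //; [exact: mulr_ge0|exact: ler_pM].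
Qed.

End hypotheses.

Theorem theorem1p13 (R : realType) (X : metricType R)
    (disconnected : ~ connected [set: X])
    (unbounded_X : unbounded X)
    (locally_compact_X : locally_compact [set: X])
    (homogeneous_X : uniformly_bilipschitz_homogeneous X)
    (quasi_invertible_X : quasi_invertible X) :
  exists f : X -> C2 R, quasi_moebius f.
Proof.
have [L L1 LP] := homogeneous_bilipschitz homogeneous_X.
have [p [c [s [s' [c1 sI]]]]] := quasi_invertible_inversion quasi_invertible_X.
have unb (B : R) : exists x y : X, B < mdist x y.
  apply: contrapT => nB; apply: unbounded_X; exists B => x y.
  by rewrite leNgt; apply/negP => xy; apply: nB; exists x, y.
have cpt : exists q (e : R) (A : set X),
    [/\ 0 < e, compact A & forall x, mdist q x < e -> A x].
  have [A pA [Ac _]] := locally_compact_X p I.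
  have {pA} : nbhs p A.
    by move: pA; rewrite /within/=; apply: filterS => x; apply.
  by move/metricType_numDomainType.nbhs_mdistP => [e e0 eA]; exists p, e, A.
pose m := Num.max L c.
have m1 : 1 <= m by rewrite le_max L1.
have Lm : L <= m by rewrite le_max lexx.
have cm : c <= m by rewrite le_max lexx orbT.
pose k := m ^+ 5.
have mk : m <= k by apply: ler_eXnr.
have k1 : 1 <= k by apply: le_trans mk.
have hom (x y : X) : exists f f', bilipschitz k f f' /\ f x = y.
  have [f [f' [fI fx]]] := LP x y; exists f, f'; split=> //.
  by apply: bilipschitz_le fI; apply: le_trans mk.
have inv (q : X) : exists tau tau', inversion k q tau tau'.
  have [f [f' [fI fp]]] := LP p q; exists (f \o s \o f'), (f \o s' \o f').
  by apply: inversion_conj fp _; [|exact: bilipschitz_le fI|exact: inversion_le sI].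
have cpl := complete_of_compact k1 hom cpt.
have [A [a [Ac Ao Aa]]] := small_compact_open k1 hom inv unb cpl disconnected cpt.
have [delta delta0 disc] := disconnected_of_compact_open k1 hom inv unb Ac Ao Aa.
have [C perf] := perfect_of_scaling k1 hom inv unb.
have dbl := doubling_of_compact k1 hom inv unb cpt.
have [w Cw] := exists_pow_gt (C / delta) (lexx 2).
apply: (@uniformization R X p delta C delta0 disc perf dbl cpl w.+1) => //.
rewrite mulrC -ltr_pdivrMr//; apply: (lt_le_trans Cw).
by rewrite ler_eXn2l// ltr1n.
Qed.
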